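(* Let $(\mathcal A,\varphi)$ be a probability space equipped with a representation $\rho:\mathbb B_\infty\to\mathrm{Aut}(\mathcal A,\varphi)$ and let $\mathcal A_{n-1}^\rho:=\mathcal A^{\rho(\mathbb B_{n+1,\infty})}$ be the fixed point algebra of $\rho(\mathbb B_{n+1,\infty})$, for $n\in\mathbb N_0$. Then $$\mathcal A_{-1}^\rho\subset\mathcal A_0^\rho\subset\mathcal A_1^\rho\subset\cdots\subset\mathcal A$$ is a tower of von Neumann algebras such that, for all $n\in\mathbb N_0$, $\rho(\sigma_{n+1})$ restricts to an automorphism of $\mathcal A_{n+1}^\rho$ and $$\begin{matrix}\rho(\sigma_{n+1})(\mathcal A_n^\rho)&\subset&\mathcal A_{n+1}^\rho\\ \cup&&\cup\\ \mathcal A_{n-1}^\rho&\subset&\mathcal A_n^\rho\end{matrix}$$ is a commuting square.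
   Context: A probability space $(\mathcal A,\varphi)$ is a von Neumann algebra $\mathcal A$ with separable predual together with a faithful normal state $\varphi$. $\mathrm{Aut}(\mathcal A,\varphi)$ is the group of $\varphi$-preserving automorphisms of $\mathcal A$; $\mathbb N_0=\{0,1,2,\dots\}$. $\mathbb B_\infty$ is generated by $\sigma_1,\sigma_2,\dots$ subject to $\sigma_i\sigma_j\sigma_i=\sigma_j\sigma_i\sigma_j$ if $|i-j|=1$ and $\sigma_i\sigma_j=\sigma_j\sigma_i$ if $|i-j|>1$; $\mathbb B_{n,\infty}:=\langle\sigma_k\mid n\le k<\infty\rangle$. For a von Neumann subalgebra $\mathcal B$ for which it exists, $E_{\mathcal B}$ denotes the $\varphi$-preserving conditional expectation of $\mathcal A$ onto $\mathcal B$; $\mathcal B$ is then called $\varphi$-conditioned (all algebras in the diagram are $\varphi$-conditioned). A square of inclusions of $\varphi$-conditioned subalgebras $$\begin{matrix}\mathcal N_2&\subset&\mathcal P\\ \cup&&\cup\\ \mathcal N&\subset&\mathcal N_1\end{matrix}$$ is a commuting square if $E_{\mathcal N_1}E_{\mathcal N_2}=E_{\mathcal N}$. *)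

(* Defs.v *)
From HB Require Import structures.
From mathcomp Require Import all_boot all_order all_algebra.
From mathcomp Require Import generic_quotient.
From mathcomp Require Import all_classical all_reals all_analysis.
From mathcomp Require Import complex.

Set Implicit Arguments.
Unset Strict Implicit.
Unset Printing Implicit Defensive.

Import Order.TTheory GRing.Theory Num.Theory Num.Def.
Import numFieldNormedType.Exports.

Local Open Scope classical_set_scope.
Local Open Scope ring_scope.

(* The letter (i, false) stands for sigma_{i+1} and (i, true) for its inverse,
   so that the generators are numbered from 1. *)
Definition braid_word := seq (nat * bool).

Definition sg (i : nat) : nat * bool := (i, false).

Inductive braid_eq : braid_word -> braid_word -> Prop :=
| braid_refl u : braid_eq u u
| braid_sym u v : braid_eq u v -> braid_eq v u
| braid_trans u v w : braid_eq u v -> braid_eq v w -> braid_eq u w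
| braid_cat u v u' v' :
    braid_eq u u' -> braid_eq v v' -> braid_eq (u ++ v) (u' ++ v')
| braid_cancel i b : braid_eq [:: (i, b); (i, ~~ b)] [::]
| braid_near i j : i = j.+1 \/ j = i.+1 ->
    braid_eq [:: sg i; sg j; sg i] [:: sg j; sg i; sg j]
| braid_far i j : (i.+1 < j)%N \/ (j.+1 < i)%N ->
    braid_eq [:: sg i; sg j] [:: sg j; sg i].

Definition braid_eqb (u v : braid_word) : bool := `[< braid_eq u v >].

Lemma braid_eqb_refl : reflexive braid_eqb.
Proof. by move=> u; apply/asboolP; exact: braid_refl. Qed.

Lemma braid_eqb_sym : symmetric braid_eqb.
Proof. by move=> u v; apply/asboolP/asboolP; exact: braid_sym. Qed.

Lemma braid_eqb_trans : transitive braid_eqb.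
Proof.
move=> v u w /asboolP uv /asboolP vw; apply/asboolP; exact: braid_trans uv vw.
Qed.

Canonical braid_equiv :=
  EquivRel braid_eqb braid_eqb_refl braid_eqb_sym braid_eqb_trans.

Definition braid : Type := {eq_quot braid_equiv}%qT.
HB.instance Definition _ := Choice.on braid.
HB.instance Definition _ := Quotient.on braid.
HB.instance Definition _ := EqQuotient.on braid.

Definition braid_class (u : braid_word) : braid := (\pi_braid u)%qT.

Lemma braid_classP (u v : braid_word) :
  braid_class u = braid_class v <-> braid_eq u v.
Proof.
split; first by move/(@eqmodP _ braid_equiv) => /asboolP.
by move=> uv; apply/(@eqmodP _ braid_equiv)/asboolP.
Qed.

Lemma braid_reprK (x : braid) : braid_class (repr x) = x.
Proof. exact: reprK. Qed.

Definition word_inv (u : braid_word) : braid_word :=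
  rev [seq (p.1, ~~ p.2) | p <- u].

Definition braid_one : braid := braid_class [::].
Definition braid_mul (x y : braid) : braid := braid_class (repr x ++ repr y).
Definition braid_inv (x : braid) : braid := braid_class (word_inv (repr x)).

Lemma braid_mulE u v :
  braid_mul (braid_class u) (braid_class v) = braid_class (u ++ v).
Proof.
by apply/braid_classP; apply: braid_cat; apply/braid_classP; exact: braid_reprK.
Qed.

Lemma word_mulV u : braid_eq (u ++ word_inv u) [::].
Proof.
elim: u => [|[i b] u IH]; first exact: braid_refl.
rewrite /word_inv /= rev_cons -cats1 catA -/(word_inv u).
apply: (braid_trans _ (braid_cancel i b)).
have h : braid_eq ((u ++ word_inv u) ++ [:: (i, ~~ b)]) ([::] ++ [:: (i, ~~ b)]).
  by apply: braid_cat => //; exact: braid_refl.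
exact: (braid_cat (braid_refl [:: (i, b)]) h).
Qed.

Lemma word_invK : involutive word_inv.
Proof.
move=> u; rewrite /word_inv map_rev revK -map_comp -[RHS]map_id.
by apply: eq_map => -[i b] /=; rewrite negbK.
Qed.

Lemma word_mulVl u : braid_eq (word_inv u ++ u) [::].
Proof. by have := word_mulV (word_inv u); rewrite word_invK. Qed.

Lemma braid_mulA : associative braid_mul.
Proof.
move=> x y z; rewrite -(braid_reprK x) -(braid_reprK y) -(braid_reprK z).
by rewrite !braid_mulE catA.
Qed.

Lemma braid_mul1 : left_id braid_one braid_mul.
Proof. by move=> x; rewrite -(braid_reprK x) braid_mulE. Qed.

Lemma braid_mulr1 : right_id braid_one braid_mul.
Proof. by move=> x; rewrite -(braid_reprK x) braid_mulE cats0. Qed.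

Lemma braid_mulVl : left_inverse braid_one braid_inv braid_mul.
Proof.
move=> x; rewrite -{2}(braid_reprK x) braid_mulE.
by apply/braid_classP; exact: word_mulVl.
Qed.

Lemma braid_mulVr : right_inverse braid_one braid_inv braid_mul.
Proof.
move=> x; rewrite -{1}(braid_reprK x) braid_mulE.
by apply/braid_classP; exact: word_mulV.
Qed.

HB.instance Definition _ := isGroup.Build braid
  braid_mulA braid_mul1 braid_mulr1 braid_mulVl braid_mulVr.

(* The generator sigma_k, meaningful for k >= 1 only. *)
Definition sigma (k : nat) : braid := braid_class [:: sg k.-1].

Definition subgroup (G : groupType) (K : set G) : Prop :=
  K 1%g /\ (forall x y, K x -> K y -> K (x * y^-1)%g).

Definition gen_subgroup (G : groupType) (S : set G) : set G :=
  smallest (@subgroup G) S.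

Definition braid_from (n : nat) : set braid :=
  gen_subgroup (sigma @` [set k | (1 <= k)%N /\ (n <= k)%N]).

Section VonNeumann.
Variables (R : realType) (H : completeNormedModType R[i]).
Variable ip : {dot H for @conjC R[i]}.

Implicit Types (A B M N P S : set (H -> H)) (x y : H -> H).
Implicit Types (phi f : (H -> H) -> R[i]) (alpha E : (H -> H) -> (H -> H)).

(* With [H] complete, this makes [H] a Hilbert space; [ip] is linear in its
   first argument. *)
Definition induces_norm : Prop := forall v : H, ip v v = `|v| ^+ 2.

Definition bounded_op : set (H -> H) :=
  [set x | (forall a u v, x (a *: u + v) = a *: x u + x v) /\ continuous x].

Definition adjoint x y : Prop := forall u v, ip (x u) v = ip u (y v).

Definition commutant S : set (H -> H) :=
  [set y | bounded_op y /\ forall x, S x -> x \o y = y \o x].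

(* A bicommutant is automatically a unital subalgebra of B(H). *)
Definition von_neumann_algebra M : Prop :=
  [/\ M `<=` bounded_op,
      forall x, M x -> exists2 y, M y & adjoint x y
    & commutant (commutant M) = M].

(* Functionals and maps on M are total functions on [H -> H] of which only the
   values on M matter.  The next predicate spells out the elements of the
   predual of M: the ultraweakly continuous linear functionals. *)
Definition normal_functional M f : Prop :=
  exists xi eta : nat -> H,
    [/\ cvgn (series (fun n => `|xi n| ^+ 2)),
        cvgn (series (fun n => `|eta n| ^+ 2))
      & forall x, M x ->
          series (fun n => ip (x (xi n)) (eta n)) @ \oo
            --> (f x : (R[i] : numFieldType))].

Definition contraction x : Prop := forall v, `|x v| <= `|v|.

Definition separable_predual M : Prop :=
  exists F : nat -> (H -> H) -> R[i],
    (forall k, normal_functional M (F k)) /\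
    forall f, normal_functional M f -> forall eps : R, 0 < eps ->
      exists k, forall x, M x -> contraction x -> `|f x - F k x| <= eps%:C%C.

Definition state M phi : Prop :=
  [/\ forall a x y, M x -> M y -> phi (a *: x + y) = a * phi x + phi y,
      forall x y, M x -> adjoint x y -> 0 <= phi (y \o x)
    & phi idfun = 1].

Definition faithful M phi : Prop :=
  forall x y, M x -> adjoint x y -> phi (y \o x) = 0 -> x = 0.

Definition probability_space A phi : Prop :=
  [/\ von_neumann_algebra A, separable_predual A, state A phi,
      normal_functional A phi & faithful A phi].

Definition automorphism M alpha : Prop :=
  [/\ set_bij M M alpha,
      forall a x y, M x -> M y -> alpha (a *: x + y) = a *: alpha x + alpha y,
      forall x y, M x -> M y -> alpha (x \o y) = alpha x \o alpha y
    & forall x y, M x -> adjoint x y -> adjoint (alpha x) (alpha y)].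

(* rho is a homomorphism from G to Aut(A, phi). *)
Definition representation (G : groupType) A phi
    (rho : G -> (H -> H) -> (H -> H)) : Prop :=
  [/\ forall g, automorphism A (rho g),
      forall g x, A x -> phi (rho g x) = phi x
    & forall g h x, A x -> rho (g * h)%g x = rho g (rho h x)].

Definition fixed_points (G : groupType) A
    (rho : G -> (H -> H) -> (H -> H)) (K : set G) : set (H -> H) :=
  [set x | A x /\ forall g, K g -> rho g x = x].

Definition conditional_expectation A phi B E : Prop :=
  [/\ [/\ forall x, A x -> B (E x),
          forall b, B b -> E b = b
        & forall a x y, A x -> A y -> E (a *: x + y) = a *: E x + E y],
      forall x y v, A x -> adjoint x y -> 0 <= ip (E (y \o x) v) v,
      forall b x c, B b -> A x -> B c -> E (b \o x \o c) = b \o E x \o c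
    & forall x, A x -> phi (E x) = phi x].

Definition conditioned A phi B : Prop :=
  [/\ von_neumann_algebra B, B `<=` A
    & exists E, conditional_expectation A phi B E].

(* The expectations are taken on the whole of A; they are unique, so that
   quantifying over all of them is harmless once they exist. *)
Definition commuting_square A phi N N1 N2 P : Prop :=
  [/\ [/\ N `<=` N1, N `<=` N2, N1 `<=` P & N2 `<=` P],
      [/\ conditioned A phi N, conditioned A phi N1, conditioned A phi N2
        & conditioned A phi P]
    & forall E E1 E2,
        conditional_expectation A phi N E ->
        conditional_expectation A phi N1 E1 ->
        conditional_expectation A phi N2 E2 ->
        forall x, A x -> E1 (E2 x) = E x].

End VonNeumann.

(* [braid_tower A rho n] is the fixed point algebra of braid_from n.+1, that is
   A_{n-1}^rho: indices are shifted by one so as to start at 0. *)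
Definition braid_tower (R : realType) (H : completeNormedModType R[i])
    (A : set (H -> H)) (rho : braid -> (H -> H) -> (H -> H)) (n : nat) :
    set (H -> H) :=
  fixed_points A rho (braid_from n.+1).

(* Main.v *)
Require Import Defs.
From HB Require Import structures.
From mathcomp Require Import all_boot all_order all_algebra.
From mathcomp Require Import all_classical all_reals all_analysis.
From mathcomp Require Import complex ring lra.
Set Implicit Arguments.
Unset Strict Implicit.
Unset Printing Implicit Defensive.
Import Order.TTheory GRing.Theory Num.Theory.
Import numFieldNormedType.Exports.
Local Open Scope classical_set_scope.
Local Open Scope ring_scope.
Local Open Scope complex_scope.

(** When a group acts by automorphisms that preserve the faithful normal state
    phi, the conditional expectation onto the fixed points is a mean ergodic
    average: in the closed convex hull of the orbit of x, the element of least
    GNS norm, |z|^2 = phi (z* z), is unique and therefore fixed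
    (average_exists). Averaging does not change the values phi (b x d) at fixed
    b and d (average_phi), and by faithfulness these values determine a fixed
    point (fixed_unique); all the properties of the expectation, and its
    uniqueness, follow (fixed_conditioned, average_unique).

    The commuting square thus reduces to one assertion
    (shifted_average_fixed): if x is fixed by all sigma_k with k >= n + 2, and
    y is the average of sigma_(n+1) x over the group that these generate, then
    y is also fixed by sigma_(n+1). Consider the elements
    w_k = sigma_(n+k+1) ... sigma_(n+2) sigma_(n+1) x. They all have the
    average y, as they lie in the orbit of sigma_(n+1) x. The braid relations
    let sigma_j slide through the word and come out as sigma_(j+1), when
    n < j <= n + k (shift_word_sigma); since sigma_(j+1) fixes x, each sigma_j
    with j > n fixes all but finitely many w_k. Let y' be the average of y over
    the group generated by the sigma_j with j > n. It is a limit of averages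
    that involve finitely many sigma_j, so the GNS inner product of y - y' with
    w_k tends to 0. But that product does not depend on k: averaging replaces
    w_k by y. Hence y - y' is orthogonal to y; being orthogonal to all fixed
    points of the larger group, it is orthogonal to y' too, and y = y'.

    The analysis takes place on the given Hilbert space H. Two sequences of
    vectors compare the GNS norm with the norm of H: a square-summable theta
    with phi (z* z) <= sum_n |z theta_n|^2 (nphi_le_vector), and zeta with
    |z zeta_n|^2 <= phi (z* z), which separates A (separating_vector). As zeta
    separates A, the vectors b zeta_n with b in the commutant of A span a dense
    subspace (commutant_span_dense). Consequently bounded GNS-Cauchy sequences
    converge pointwise on H (nphi_complete), bounded pointwise limits are GNS
    limits (pointwise_null_nphi), and automorphisms that preserve phi do not
    increase operator norms (automorphism_bound), so hulls of orbits are
    bounded. That the fixed points form a von Neumann algebra comes from theta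
    and the bicommutant theorem on the square-summable sequences in H
    (bicommutant_approx, fixed_von_neumann). *)

(** * Null sequences and minimizing sequences *)

Section Sequences.
Variable R : realType.
Implicit Types (a b : nat -> R).

Lemma null_squeeze a b : (forall n, 0 <= a n <= b n) ->
  b @ \oo --> (0 : R) -> a @ \oo --> (0 : R).
Proof.
move=> ab b0; apply: (squeeze_cvgr _ (cvg_cst (0 : R)) b0).
exact: nearW.
Qed.

Lemma null_sqr a : (fun n => a n ^+ 2) @ \oo --> (0 : R) ->
  a @ \oo --> (0 : R).
Proof.
move=> /cvgrPdist_le a0; apply/cvgrPdist_le => e e0.
have := a0 (e ^+ 2) (exprn_gt0 _ e0); apply: filterS => n.
rewrite !sub0r !normrN normrX => h.
by rewrite -(@ler_pXn2r _ 2) ?nnegrE ?normr_ge0 // ltW.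
Qed.

Lemma null_harmonic : (fun n => n.+1%:R^-1) @ \oo --> (0 : R).
Proof. exact: cvg_harmonic. Qed.

Lemma null_le a : a @ \oo --> (0 : R) -> forall e : R, 0 < e ->
  exists N, forall n, (N <= n)%N -> `|a n| <= e.
Proof.
move=> /cvgrPdist_le a0 e e0; have [N _ h] := a0 e e0; exists N => n Nn.
by have := h n Nn; rewrite sub0r normrN.
Qed.

Lemma le_null a : (forall e : R, 0 < e ->
  exists N, forall n, (N <= n)%N -> `|a n| <= e) -> a @ \oo --> (0 : R).
Proof.
move=> h; apply/cvgrPdist_le => e e0; have [N hN] := h e e0.
by exists N => // n /= Nn; rewrite sub0r normrN; apply: hN.
Qed.

Lemma cvg_const_eq (x y : R) a : (forall n, a n = x) -> a @ \oo --> y -> x = y.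
Proof.
move=> ax ay; have ac : a @ \oo --> x.
  by rewrite (_ : a = cst x); [exact: cvg_cst|apply/funext].
by apply: cvg_unique ac ay.
Qed.

(** The variational principle behind the Riesz representation and the mean
    ergodic theorem: a midpoint of two near minimizers cannot lie far below the
    infimum, so the defect Q / 4 in the midpoint inequality is small for them. *)
Lemma minimizing_sequence (T : Type) (K : set T) (J : T -> R) (Q : T -> T -> R)
    (c : R) : K !=set0 -> (forall x, K x -> c <= J x) ->
  (forall x y, K x -> K y ->
     exists2 m, K m & J m <= (J x + J y) / 2 - Q x y / 4) ->
  exists u : nat -> T,
    [/\ forall k, K (u k),
        forall k l, Q (u k) (u l) <= 2 * (k.+1%:R^-1 + l.+1%:R^-1)
      & forall z k, K z -> J (u k) <= J z + k.+1%:R^-1].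
Proof.
move=> [x0 Kx0] Jc mid.
have hlb : has_inf (J @` K).
  by split; [exists (J x0), x0|exists c => _ [a Ka <-]; exact: Jc].
pose d := inf (J @` K).
have dJ z : K z -> d <= J z.
  by move=> Kz; apply: ge_inf; [case: hlb|exists z].
have /choice[u hu] k : exists z, K z /\ J z <= d + k.+1%:R^-1.
  have e0 : 0 < (k.+1%:R^-1 : R) by rewrite invr_gt0 ltr0n.
  have [_ [z Kz <-] /ltW zd] := inf_adherent e0 hlb.
  by exists z.
exists u; split => [k|k l|z k Kz]; first by case: (hu k).
- have [Kk Jk] := hu k; have [Kl Jl] := hu l.
  have [m Km Jm] := mid _ _ Kk Kl; have {Jm} := le_trans (dJ m Km) Jm.
  move: Jk Jl; set x := k.+1%:R^-1; set y := l.+1%:R^-1; clearbody d x y; lra.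
- by have [_ Jk] := hu k; apply: (le_trans Jk); rewrite lerD2r dJ.
Qed.

End Sequences.

(** * Real Hilbert forms: Riesz representation and projections *)

Section HilbertForm.
Variables (R : realType) (V : lmodType R[i]).
Implicit Types (r : V -> V -> R).

Definition tends r (u : nat -> V) (l : V) : Prop :=
  (fun n => r (u n - l) (u n - l)) @ \oo --> (0 : R).

(** Only the real part of an inner product is recorded; complex linearity of
    projections is recovered by viewing multiplication by a complex number as
    an operator that has an adjoint. *)
Record hilbert_form r : Prop := HilbertForm {
  form_sym : forall u v, r u v = r v u;
  form_add : forall u v w, r (u + v) w = r u w + r v w;
  form_scale : forall (a : R) u v, r (a%:C *: u) v = a * r u v;
  form_ge0 : forall u, 0 <= r u u;
  form_eq0 : forall u, r u u = 0 -> u = 0;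
  form_complete : forall u : nat -> V,
    (forall e : R, 0 < e -> exists N, forall m n, (N <= m)%N -> (N <= n)%N ->
       r (u m - u n) (u m - u n) <= e) ->
    exists l, tends r u l }.

End HilbertForm.

Section HilbertFormTheory.
Variables (R : realType) (V : lmodType R[i]).

Variable r : V -> V -> R.
Hypothesis hr : hilbert_form r.
Local Notation q v := (r v v).

Lemma form_addr u v w : r w (u + v) = r w u + r w v.
Proof. by rewrite !(form_sym hr w) (form_add hr). Qed.

Lemma form_scaler (a : R) u v : r v (a%:C *: u) = a * r v u.
Proof. by rewrite !(form_sym hr v) (form_scale hr). Qed.

Lemma form_opp u v : r (- u) v = - r u v.
Proof.
have -> : - u = (-1)%:C *: u by rewrite rmorphN rmorph1 scaleN1r.
by rewrite (form_scale hr) mulN1r.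
Qed.

Lemma form_oppr u v : r v (- u) = - r v u.
Proof. by rewrite !(form_sym hr v) form_opp. Qed.

Lemma form_sub u v w : r (u - v) w = r u w - r v w.
Proof. by rewrite (form_add hr) form_opp. Qed.

Lemma form_subr u v w : r w (u - v) = r w u - r w v.
Proof. by rewrite form_addr form_oppr. Qed.

Lemma form_zero v : r 0 v = 0.
Proof. by rewrite -(subrr v) form_sub subrr. Qed.

Lemma form_zeror v : r v 0 = 0.
Proof. by rewrite (form_sym hr) form_zero. Qed.

Lemma form_qD u v : q (u + v) = q u + 2 * r u v + q v.
Proof. by rewrite (form_add hr) !form_addr (form_sym hr v u); ring. Qed.

Lemma form_qB u v : q (u - v) = q u - 2 * r u v + q v.
Proof. by rewrite form_qD form_oppr form_opp form_oppr; ring. Qed.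

Lemma form_qZ (a : R) u : q (a%:C *: u) = a ^+ 2 * q u.
Proof. by rewrite (form_scale hr) form_scaler; ring. Qed.

Lemma form_qBC u v : q (u - v) = q (v - u).
Proof. by rewrite !form_qB (form_sym hr u v); ring. Qed.

Lemma form_qD_le u v : q (u + v) <= 2 * (q u + q v).
Proof.
have := form_ge0 hr (u - v); rewrite form_qB form_qD; lra.
Qed.

Lemma form_CS u v : r u v ^+ 2 <= q u * q v.
Proof.
have [v0|v0] := eqVneq (q v) 0.
  by rewrite v0 (form_eq0 hr v0) form_zeror expr0n mulr0.
have qv : 0 < q v by rewrite lt_def v0 (form_ge0 hr).
have := form_ge0 hr (u - (r u v / q v)%:C *: v).
rewrite form_qB form_qZ form_scaler => h.
rewrite -subr_ge0.
have -> : q u * q v - r u v ^+ 2 =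
    q v * (q u - 2 * (r u v / q v * r u v) + (r u v / q v) ^+ 2 * q v).
  by field.
by apply: mulr_ge0 => //; exact: ltW.
Qed.

Lemma tends_cst l : tends r (fun=> l) l.
Proof. by rewrite /tends; under eq_fun do rewrite subrr form_zero; exact: cvg_cst. Qed.

Lemma tends_map (W : lmodType R[i]) (s : W -> W -> R) (T : V -> W) (C : R) u l :
  hilbert_form s ->
  {morph T : x y / x - y} -> (forall v, s (T v) (T v) <= C * q v) ->
  tends r u l -> tends s (T \o u) (T l).
Proof.
move=> hs TB TC ul; apply: (@null_squeeze _ _ (fun n => C * q (u n - l))).
  by move=> n /=; rewrite -TB (form_ge0 hs) TC.
by rewrite -(mulr0 C); apply: cvgM => //; exact: cvg_cst.
Qed.

Lemma tends_form u l w : tends r u l -> (fun n => r (u n) w) @ \oo --> r l w.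
Proof.
move=> ul.
have -> : (fun n => r (u n) w) = (fun n => r (u n - l) w + r l w).
  by apply/funext => n; rewrite form_sub subrK.
rewrite -[X in _ --> X]add0r; apply: cvgD; last exact: cvg_cst.
apply: null_sqr; apply: (@null_squeeze _ _ (fun n => q (u n - l) * q w)).
  by move=> n /=; rewrite sqr_ge0 form_CS.
by rewrite -(mul0r (q w)); apply: cvgM => //; exact: cvg_cst.
Qed.

Lemma tends_q u l : tends r u l -> (fun n => q (u n)) @ \oo --> q l.
Proof.
move=> ul.
have -> : (fun n => q (u n)) =
    (fun n => q (u n - l) + 2 * r (u n) l - q l).
  by apply/funext => n; rewrite form_qB; ring.
rewrite [X in _ --> X](_ : _ = 0 + 2 * r l l - r l l); last by ring.
apply: cvgB; last exact: cvg_cst.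
by apply: cvgD => //; apply: cvgM; [exact: cvg_cst|exact: tends_form].
Qed.

Lemma tendsB u v l m : tends r u l -> tends r v m ->
  tends r (fun n => u n - v n) (l - m).
Proof.
move=> ul vm.
apply: (@null_squeeze _ _ (fun n => 2 * (q (u n - l) + q (v n - m)))).
  move=> n /=; rewrite (form_ge0 hr) /=.
  have -> : u n - v n - (l - m) = (u n - l) + (m - v n).
    by rewrite !opprD !opprK addrACA [- v n + m]addrC.
  by apply: (le_trans (form_qD_le _ _)); rewrite (form_qBC m).
rewrite -[X in _ --> X](mulr0 2) -[X in _ * X](addr0 0).
by apply: cvgM; [exact: cvg_cst|exact: cvgD].
Qed.

Lemma tends_unique u l m : tends r u l -> tends r u m -> l = m.
Proof.
move=> ul um; apply/eqP; rewrite -subr_eq0; apply/eqP/(form_eq0 hr).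
apply/esym; apply: (cvg_const_eq _ (tends_q (tendsB ul um))) => n.
by rewrite subrr form_zero.
Qed.

(** The representing vector is the limit of a minimizing sequence of
    q (j x) - 2 F x. The subspace D is only mapped into V, so that F may be
    given on D itself: below D is an algebra of operators and j evaluates them
    at a vector. *)
Lemma riesz (T : lmodType R[i]) (D : set T) (j : T -> V) (F : T -> R) (c : R) :
  D 0 -> (forall (a : R) x y, D x -> D y -> D (a%:C *: x + y)) ->
  (forall (a : R) x y, D x -> D y -> j (a%:C *: x + y) = a%:C *: j x + j y) ->
  (forall (a : R) x y, D x -> D y -> F (a%:C *: x + y) = a * F x + F y) ->
  (forall x, D x -> 2 * F x - q (j x) <= c) ->
  exists2 z, exists2 u : nat -> T, forall k, D (u k) & tends r (j \o u) z
    & forall x, D x -> r (j x) z = F x.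
Proof.
move=> D0 DL jL FL Fc.
have DZ (a : R) x : D x -> D (a%:C *: x).
  by move=> Dx; rewrite -[_ *: _]addr0; apply: DL.
have j0 : j 0 = 0.
  have := jL 1 0 0 D0 D0; rewrite scaler0 addr0 scale1r.
  by move/(congr1 (fun z => z - j 0)); rewrite subrr addrK.
have F0 : F 0 = 0.
  by have := FL 1 0 0 D0 D0; rewrite scaler0 addr0; lra.
have jZ (a : R) x : D x -> j (a%:C *: x) = a%:C *: j x.
  by move=> Dx; have := jL a x 0 Dx D0; rewrite !addr0 j0 addr0.
have FZ (a : R) x : D x -> F (a%:C *: x) = a * F x.
  by move=> Dx; have := FL a x 0 Dx D0; rewrite addr0 F0 addr0.
pose J x := q (j x) - 2 * F x.
have Jc x : D x -> - c <= J x by move=> /Fc; rewrite /J; lra.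
have mid x y : D x -> D y ->
    exists2 m, D m & J m <= (J x + J y) / 2 - q (j x - j y) / 4.
  move=> Dx Dy; exists ((2^-1)%:C *: x + (2^-1)%:C *: y).
    by apply: DL => //; exact: DZ.
  rewrite /J jL ?FL ?jZ ?FZ //; try exact: DZ.
  by rewrite form_qB form_qD !form_qZ (form_scale hr) form_scaler; lra.
have [u [Du uQ uJ]] := minimizing_sequence (ex_intro _ _ D0) Jc mid.
have [z uz] : exists z, tends r (j \o u) z.
  apply: (form_complete hr) => e e0.
  have [N hN] := null_le (@null_harmonic R) (divr_gt0 e0 (ltr0n R 4)).
  exists N => m n /hN hm /hN hn; apply: (le_trans (uQ m n)).
  move: hm hn; rewrite !ger0_norm ?invr_ge0 //.
  by set a := m.+1%:R^-1; set b := n.+1%:R^-1; clearbody a b; lra.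
exists z; first by exists u.
move=> x Dx; apply/eqP; rewrite -subr_eq0; apply/eqP.
set w := _ - _.
(* The first variation of J at z in the direction x. *)
have var t : 0 <= 2 * t * w + t ^+ 2 * q (j x).
  suff : (fun n => 2 * t * (r (j (u n)) (j x) - F x) + t ^+ 2 * q (j x)
      + n.+1%:R^-1) @ \oo --> 2 * t * w + t ^+ 2 * q (j x) + 0.
    rewrite addr0 => h.
    apply: (@cvgr_to_ge _ _ _ _ _ _ 0 h); apply: nearW => n.
    have Dt : D (t%:C *: x + u n) by apply: DL.
    have := uJ _ n Dt; rewrite /J jL // FL // form_qD form_qZ (form_scale hr).
    rewrite (form_sym hr (j x) (j (u n))).
    by set a := n.+1%:R^-1; clearbody a; lra.
  apply: cvgD; last exact: null_harmonic.
  apply: cvgD; last exact: cvg_cst.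
  apply: cvgM; first exact: cvg_cst.
  apply: cvgB; last exact: cvg_cst.
  by rewrite (form_sym hr (j x) z); exact: tends_form.
have qx := form_ge0 hr (j x).
have q1 : 0 < q (j x) + 1 by lra.
(* Close to the minimum of the quadratic; the 1 covers the case q (j x) = 0. *)
have := var (- w / (q (j x) + 1)).
have -> : 2 * (- w / (q (j x) + 1)) * w + (- w / (q (j x) + 1)) ^+ 2 * q (j x)
    = - (w ^+ 2 * (q (j x) + 2) / (q (j x) + 1) ^+ 2).
  by field; rewrite gt_eqF.
rewrite oppr_ge0 pmulr_lle0 ?invr_gt0 ?exprn_gt0 //.
rewrite pmulr_lle0; last by lra.
by move=> h; apply/eqP; rewrite -sqrf_eq0 eq_le h sqr_ge0.
Qed.

Definition adherent (L : set V) (p : V) : Prop :=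
  exists2 u : nat -> V, forall k, L (u k) & tends r u p.

Definition is_proj (L : set V) (P : V -> V) : Prop :=
  forall v, adherent L (P v) /\ forall l, L l -> r l (v - P v) = 0.

Definition real_subspace (L : set V) : Prop :=
  L 0 /\ forall (a : R) x y, L x -> L y -> L (a%:C *: x + y).

Lemma proj_exists L : real_subspace L -> exists P, is_proj L P.
Proof.
move=> [L0 LL].
suff /choice[P hP] : forall v, exists p,
    adherent L p /\ forall l, L l -> r l (v - p) = 0 by exists P.
move=> v.
have [||x Lx|z [u Lu uz] hz] := @riesz V L id (r^~ v) (q v) L0 LL.
- by [].
- by move=> a x y _ _; rewrite (form_add hr) (form_scale hr).
- by have := form_ge0 hr (x - v); have := form_qB x v; lra.
exists z; split; first by exists u.
by move=> l Ll; rewrite form_subr hz // subrr.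
Qed.

Lemma adherent_perp (L : set V) p w :
  adherent L p -> (forall l, L l -> r l w = 0) -> r p w = 0.
Proof.
move=> [u Lu up] h; apply/esym.
by apply: cvg_const_eq (tends_form up) => n; exact: h.
Qed.

Lemma proj_unique L P v p : is_proj L P ->
  adherent L p -> (forall l, L l -> r l (v - p) = 0) -> p = P v.
Proof.
move=> /(_ v)[Pv Pp] Lp hp; apply/eqP; rewrite -subr_eq0; apply/eqP.
apply: (form_eq0 hr).
have h l : L l -> r l (p - P v) = 0.
  move=> Ll; have -> : p - P v = (v - P v) - (v - p).
    by rewrite opprB [RHS]addrC addrA subrK.
  by rewrite form_subr Pp // hp // subrr.
by rewrite form_sub !(adherent_perp _ h) // subrr.
Qed.

Lemma proj_id L P l : is_proj L P -> L l -> P l = l.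
Proof.
move=> hP Ll; apply/esym/(proj_unique hP).
  by exists (fun=> l) => //; exact: tends_cst.
by move=> k _; rewrite subrr form_zeror.
Qed.

Lemma proj_contraction L P v : is_proj L P -> q (P v) <= q v.
Proof.
move=> hP; have [Pv Pp] := hP v.
have h := adherent_perp Pv Pp.
have -> : q v = q (P v + (v - P v)) by rewrite addrC subrK.
by rewrite form_qD h; have := form_ge0 hr (v - P v); lra.
Qed.

(** T preserves the closure of L by continuity, and the orthogonal complement
    of L because its adjoint S preserves L. *)
Lemma proj_commute L P (T S : V -> V) (C : R) v : is_proj L P ->
  {morph T : x y / x - y} -> (forall u, q (T u) <= C * q u) ->
  (forall x y, r (T x) y = r x (S y)) ->
  (forall l, L l -> L (T l)) -> (forall l, L l -> L (S l)) ->
  P (T v) = T (P v).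
Proof.
move=> hP TB TC TS LT LS; have [[u Lu uP] Pp] := hP v.
apply/esym/(proj_unique hP).
  by exists (T \o u) => [k|]; [exact/LT/Lu|exact: tends_map uP].
move=> l Ll; rewrite -TB (form_sym hr) TS (form_sym hr); exact/Pp/LS.
Qed.

Lemma proj_additive L P : real_subspace L -> is_proj L P ->
  {morph P : x y / x - y}.
Proof.
move=> [_ LL] hP x y; apply/esym/(proj_unique hP).
  have [[u Lu uP] _] := hP x; have [[w Lw wP] _] := hP y.
  exists (fun n => u n - w n); last exact: tendsB.
  move=> k; have := LL (-1) _ _ (Lw k) (Lu k).
  by rewrite rmorphN rmorph1 scaleN1r addrC.
move=> l Ll; have [_ hx] := hP x; have [_ hy] := hP y.
have -> : x - y - (P x - P y) = (x - P x) - (y - P y).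
  by rewrite !opprD !opprK addrACA.
by rewrite form_subr hx // hy // subrr.
Qed.

End HilbertFormTheory.

Local Notation Re := complex.Re.
Local Notation Im := complex.Im.

(** * The Hilbert space and its bounded operators *)

Section ComplexParts.
Variable R : realType.
Implicit Types (z w : R[i]).

Lemma ReD z w : Re (z + w) = Re z + Re w.
Proof. by case: z w => [a b] [c d]; reflexivity. Qed.

Lemma ReN z : Re (- z) = - Re z.
Proof. by case: z; reflexivity. Qed.

Lemma ReZ (a : R) z : Re (a%:C * z) = a * Re z.
Proof. by case: z => b c; simpc. Qed.

Lemma Re_sum (I : Type) (r : seq I) (P : pred I) (F : I -> R[i]) :
  Re (\sum_(i <- r | P i) F i) = \sum_(i <- r | P i) Re (F i).
Proof. by apply: (big_morph (@complex.Re R)) => // z w; exact: ReD. Qed.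

Lemma Re_conj z : Re (Num.conj z) = Re z.
Proof. by case: z; reflexivity. Qed.

Lemma Re_ge0 z : 0 <= z -> z = (Re z)%:C /\ 0 <= Re z.
Proof. by case: z => a b; rewrite lecE /= => /andP[/eqP -> ->]. Qed.

Lemma Re_gt0 z : 0 < z -> z = (Re z)%:C /\ 0 < Re z.
Proof. by case: z => a b; rewrite ltcE /= => /andP[/eqP -> ->]. Qed.

Lemma Re_iM z : Re ('i%C * z) = - Im z.
Proof. by rewrite mulrC ReiNIm. Qed.

Lemma conj_i : Num.conj 'i%C = - 'i%C :> R[i].
Proof. by apply/eqP; rewrite eq_complex /= oppr0 !eqxx. Qed.

Lemma complex_eq z w : Re z = Re w -> Re ('i%C * z) = Re ('i%C * w) -> z = w.
Proof.
rewrite !Re_iM => h /oppr_inj h'.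
by apply/eqP; rewrite eq_complex h h' !eqxx.
Qed.

Lemma cvg_Re (u : nat -> R[i]) z :
  u @ \oo --> (z : (R[i] : numFieldType)) -> (fun n => Re (u n)) @ \oo --> Re z.
Proof.
move=> uz; apply/cvgrPdist_le => e e0.
have ec : (0 : R[i]) < e%:C by rewrite ltcR.
pose K : numFieldType := R[i].
have /(@cvgrPdist_le K K^o _ \oo _ u z)/(_ _ ec) := uz; apply: filterS => n h /=.
rewrite -ReN -ReD -lecR; apply: le_trans h; exact: normc_ge_Re.
Qed.

End ComplexParts.

Section Hilbert.
Variables (R : realType) (H : completeNormedModType R[i]).
Variable ip : {dot H for @Num.conj R[i]}.
Definition real_ip (u v : H) : R := Re (ip u v).
Local Notation rip := real_ip.
Local Notation nsq v := (rip v v).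

Lemma ipDl u v w : ip (u + v) w = ip u w + ip v w.
Proof. by rewrite linearDl. Qed.

Lemma ipZl a u w : ip (a *: u) w = a * ip u w.
Proof. by rewrite linearZl_LR. Qed.

Lemma ipC u v : ip u v = Num.conj (ip v u).
Proof. by rewrite (hermC ip) expr0 mul1r. Qed.

Lemma ipDr u v w : ip w (u + v) = ip w u + ip w v.
Proof. by rewrite linearDr. Qed.

Lemma ipZr a u w : ip w (a *: u) = Num.conj a * ip w u.
Proof. by rewrite ipC ipZl rmorphM [in RHS]ipC. Qed.

Lemma nsq_ge0 v : 0 <= nsq v.
Proof. by case: (Re_ge0 (dnorm_ge0 ip v)). Qed.

Lemma nsqZ (a : R[i]) v : nsq (a *: v) = Re (`|a| ^+ 2) * nsq v.
Proof.
have [aE _] := Re_ge0 (exprn_ge0 2 (normr_ge0 a)).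
by rewrite /real_ip dnormZ aE ReZ.
Qed.

Lemma nsq0 : nsq 0 = 0.
Proof. by rewrite /real_ip linear0l. Qed.

Lemma nsqD_le u v : nsq (u + v) <= 2 * (nsq u + nsq v).
Proof.
have := nsq_ge0 (u - v); rewrite /real_ip -[- v]scaleN1r.
rewrite !(ipDl, ipDr) !(ipZl, ipZr) rmorphN rmorph1 !mulN1r !(ReD, ReN).
lra.
Qed.

Hypothesis ip_norm : induces_norm ip.

Lemma nsqE v : `|v| ^+ 2 = (nsq v)%:C.
Proof.
by rewrite -ip_norm; case: (Re_ge0 (dnorm_ge0 ip v)).
Qed.

Lemma le_norm_nsq (c : R) v w : 0 <= c ->
  (`|v| <= c%:C * `|w|) = (nsq v <= c ^+ 2 * nsq w).
Proof.
move=> c0; rewrite -lecR rmorphM rmorphXn /= -!nsqE -exprMn.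
by rewrite ler_pXn2r // nnegrE ?mulr_ge0 // lecR.
Qed.

Lemma norm_lt_nsq (c : R) v : 0 < c -> (`|v| < c%:C) = (nsq v < c ^+ 2).
Proof.
move=> c0; rewrite -ltcR rmorphXn /= -nsqE.
by rewrite ltr_pXn2r // nnegrE // lecR ltW.
Qed.

Lemma real_ip_hilbert : hilbert_form rip.
Proof.
split.
- by move=> u v; rewrite /real_ip ipC Re_conj.
- by move=> u v w; rewrite /real_ip ipDl ReD.
- by move=> a u v; rewrite /real_ip ipZl ReZ.
- by move=> u; case: (Re_ge0 (dnorm_ge0 ip u)).
- move=> u h; apply/eqP; rewrite -(dnorm_eq0 ip); have := nsqE u.
  by rewrite h -ip_norm => ->.
move=> u uC.
have /cauchy_cvgP/cvg_ex[l /= ul] : cauchy (u @ \oo).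
  apply/cauchy_ballP => e /Re_gt0[-> e0].
  have [|N hN] := uC ((Re e) ^+ 2 / 2); first by rewrite divr_gt0 ?exprn_gt0.
  near=> x y.
  rewrite -ball_normE /= norm_lt_nsq //.
  apply: (@le_lt_trans _ _ ((Re e) ^+ 2 / 2)).
    suff [[m Nm ->] [n Nn ->]] :
      (exists2 m, (N <= m)%N & x = u m) /\ (exists2 n, (N <= n)%N & y = u n).
      exact: hN.
    split; [near: x|near: y]; exists N => // n Nn /=; by exists n.
  by rewrite ltr_pdivrMr // ltr_pMr ?exprn_gt0 // ltr1n.
exists l; apply: le_null => e e0.
have s0 : 0 < Num.sqrt e by rewrite sqrtr_gt0.
have sc : (0 : R[i]) < (Num.sqrt e)%:C by rewrite ltcR.
have [N _ hN] := (iffLR (cvgrPdistC_lt _ _) ul) _ sc; exists N => n Nn.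
have := hN n Nn; rewrite /= norm_lt_nsq // (sqr_sqrtr (ltW e0)) => /ltW h.
by rewrite ger0_norm //; case: (Re_ge0 (dnorm_ge0 ip (u n - l))).
Unshelve. all: by end_near. Qed.

(** The constant bounds the square of the operator norm; squares keep all the
    estimates in R, while the norm of H has values in R[i]. *)
Definition op_bound (x : H -> H) (c : R) : Prop :=
  0 <= c /\ forall v, nsq (x v) <= c * nsq v.

Definition complex_linear (x : H -> H) : Prop :=
  forall a u v, x (a *: u + v) = a *: x u + x v.

Lemma bounded_opP (x : H -> H) :
  bounded_op x <-> complex_linear x /\ exists c, op_bound x c.
Proof.
have pack : complex_linear x -> exists f : {linear H -> H}, x = f.
  move=> xl; pose L := GRing.isLinear.Build R[i] H H *:%R x xl.
  pose f : {linear H -> H} := HB.pack x L.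
  by exists f.
split=> [[xl xc]|[xl [c [c0 xb]]]]; have [f fx] := pack xl; subst x.
  split=> //; have /linear_boundedP/pinfty_ex_gt0[r r0 fr] :=
    continuous_linear_bounded 0 (xc 0).
  have [rE R0] := Re_gt0 r0; exists ((Re r) ^+ 2); split; first exact: sqr_ge0.
  by move=> v; rewrite -(le_norm_nsq (f v) v (ltW R0)) -rE.
split=> //; apply/linear_bounded_continuous/linear_boundedP.
exists (Num.sqrt c)%:C; split; first by rewrite realE lecR sqrtr_ge0.
move=> r cr v; apply: (@le_trans _ _ ((Num.sqrt c)%:C * `|v|)).
  by rewrite le_norm_nsq ?sqrtr_ge0 // sqr_sqrtr.
by apply: ler_wpM2r => //; exact: ltW.
Qed.

Lemma op0 x : complex_linear x -> x 0 = 0.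
Proof.
move=> xl; have := xl 1 0 0; rewrite scaler0 addr0 scale1r.
by move/(congr1 (fun z => z - x 0)); rewrite subrr addrK.
Qed.

Lemma opD x u v : complex_linear x -> x (u + v) = x u + x v.
Proof. by move=> xl; have := xl 1 u v; rewrite !scale1r. Qed.

Lemma opZ x a u : complex_linear x -> x (a *: u) = a *: x u.
Proof.
by move=> xl; have := xl a u 0; rewrite (op0 xl) !addr0.
Qed.

Lemma opB x u v : complex_linear x -> x (u - v) = x u - x v.
Proof.
by move=> xl; rewrite opD // -scaleN1r opZ // scaleN1r.
Qed.

End Hilbert.

(** * Square-summable sequences in a Hilbert space *)

Section SquareSummable.
Variables (R : realType) (H : completeNormedModType R[i]).
Variable ip : {dot H for @Num.conj R[i]}.
Local Notation rip := (real_ip ip).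
Local Notation nsq v := (rip v v).

Definition square_summable : {pred nat -> H} :=
  fun u => `[< exists C, forall N, series (fun n => nsq (u n)) N <= C >].

Lemma square_summable_closed : submod_closed square_summable.
Proof.
split=> [|a u v /asboolP[C hC] /asboolP[D hD]]; apply/asboolP.
  by exists 0 => N; rewrite /series /= big1 // => i _; rewrite nsq0.
have a0 : 0 <= Re (`|a| ^+ 2) by have [] := Re_ge0 (exprn_ge0 2 (normr_ge0 a)).
exists (2 * (Re (`|a| ^+ 2) * C + D)) => N.
apply: (@le_trans _ _ (2 * (Re (`|a| ^+ 2) * series (fun n => nsq (u n)) N
    + series (fun n => nsq (v n)) N))).
  rewrite /series /= mulr_sumr -big_split /= mulr_sumr.
  apply: ler_sum => i _; by apply: (le_trans (nsqD_le _ _ _)); rewrite nsqZ.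
by apply: ler_wpM2l => //; apply: lerD => //; exact: ler_wpM2l.
Qed.

HB.instance Definition _ :=
  GRing.isSubmodClosed.Build R[i] (nat -> H) square_summable
    square_summable_closed.

Record l2 : Type := L2 { l2val :> nat -> H; _ : l2val \in square_summable }.

HB.instance Definition _ := [isSub for l2val].
HB.instance Definition _ := [Choice of l2 by <:].
HB.instance Definition _ := [SubChoice_isSubLmodule of l2 by <:].

Lemma l2D (u v : l2) n : (u + v) n = u n + v n.
Proof. by []. Qed.
Lemma l2B (u v : l2) n : (u - v) n = u n - v n.
Proof. by []. Qed.
Lemma l2Z a (u : l2) n : (a *: u) n = a *: u n.
Proof. by []. Qed.

Hypothesis ip_norm : induces_norm ip.
Local Notation hH := (real_ip_hilbert ip_norm).

Definition rl2 (u v : l2) : R := limn (series (fun n => rip (u n) (v n))).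
Local Notation q2 u := (rl2 u u).

Lemma l2_ext (u v : l2) : (forall n, u n = v n) -> u = v.
Proof. by move=> h; apply/val_inj/funext. Qed.

Lemma series_nd (a : nat -> R) : (forall n, 0 <= a n) ->
  nondecreasing_seq (series a).
Proof. by move=> a0; apply: nondecreasing_series => n _ _. Qed.

Lemma l2_nsq_cvg (u : l2) : cvgn (series (fun n => nsq (u n))).
Proof.
apply: nondecreasing_is_cvgn; first by apply: series_nd => n; exact: nsq_ge0.
case: u => u /= /asboolP[C hC]; by exists C => _ [n _ <-].
Qed.

Lemma l2_cvg (u v : l2) : cvgn (series (fun n => rip (u n) (v n))).
Proof.
apply: normed_cvg.
apply: (@series_le_cvg _ _ (fun n => nsq (u n) + nsq (v n))) => [n|n|n|].
- exact: normr_ge0.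
- by rewrite addr_ge0 // nsq_ge0.
- have := form_ge0 hH (u n + v n); have := form_ge0 hH (u n - v n).
  rewrite (form_qB hH) (form_qD hH) ler_norml.
  have := nsq_ge0 ip (u n); have := nsq_ge0 ip (v n).
  by move=> h1 h2 h3 h4; apply/andP; split; lra.
rewrite (_ : series _ = series (fun n => nsq (u n)) +
    series (fun n => nsq (v n))); last first.
  by apply/funext => n; rewrite /series /= big_split.
by apply: is_cvgD; exact: l2_nsq_cvg.
Qed.

Lemma l2_partial (u : l2) N : series (fun n => nsq (u n)) N <= q2 u.
Proof.
apply: nondecreasing_cvgn_le; last exact: l2_nsq_cvg.
by apply: series_nd => n; exact: nsq_ge0.
Qed.

Lemma l2_bound (u : l2) C :
  (forall N, series (fun n => nsq (u n)) N <= C) -> q2 u <= C.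
Proof. by move=> h; apply: limr_le; [exact: l2_nsq_cvg|exact: nearW]. Qed.

Lemma l2_coord (u : l2) n : nsq (u n) <= q2 u.
Proof.
apply: le_trans (l2_partial u n.+1); rewrite /series /= big_nat_recr //=.
by rewrite lerDr sumr_ge0 // => i _; exact: nsq_ge0.
Qed.

Lemma rl2_hilbert : hilbert_form rl2.
Proof.
split.
- move=> u v; congr (limn _); apply/funext => N; rewrite /series /=; apply: eq_bigr => n _. 
  by rewrite (form_sym hH).
- move=> u v w; apply: cvg_lim => //.
  rewrite (_ : series _ = fun N => series (fun n => rip (u n) (w n)) N +
      series (fun n => rip (v n) (w n)) N).
    by apply: cvgD; exact: l2_cvg.
  apply/funext => N; rewrite /series /= -big_split /=.
  by apply: eq_bigr => n _; rewrite (form_add hH).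
- move=> a u v; apply: cvg_lim => //.
  rewrite (_ : series _ = fun N => a * series (fun n => rip (u n) (v n)) N).
    by apply: cvgM; [exact: cvg_cst|exact: l2_cvg].
  apply/funext => N; rewrite /series /= mulr_sumr.
  by apply: eq_bigr => n _; rewrite (form_scale hH).
- move=> u; apply: limr_ge; first exact: l2_nsq_cvg.
  by apply: nearW => n; apply: sumr_ge0 => i _; exact: nsq_ge0.
- move=> u u0; apply: l2_ext => n; apply: (form_eq0 hH); apply/eqP.
  by rewrite eq_le nsq_ge0 // andbT -u0 l2_coord.
move=> u uC.
have /choice[l hl] : forall n, exists z, tends rip (fun k => u k n) z.
  move=> n; apply: (form_complete hH) => e /uC[N hN]; exists N => i j Ni Nj.
  by apply: le_trans (hN i j Ni Nj); rewrite -l2B l2_coord.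
have fatou e : 0 < e -> exists N, forall k, (N <= k)%N ->
    forall M, series (fun n => nsq (u k n - l n)) M <= e.
  move=> /uC[N hN]; exists N => k Nk M.
  suff h : (fun j => series (fun n => nsq (u k n - u j n)) M) @ \oo -->
      series (fun n => nsq (u k n - l n)) M.
    apply: (@cvgr_to_le _ _ _ _ _ _ e h); exists N => // j /= Nj.
    by apply: le_trans (hN k j Nk Nj); exact: (l2_partial (u k - u j)).
  rewrite /series /=; elim: M => [|M IH].
    by under eq_fun do rewrite big_geq //; rewrite big_geq //; exact: cvg_cst.
  under eq_fun do rewrite big_nat_recr //=.
  rewrite big_nat_recr //=; apply: cvgD => //.
  apply: (tends_q hH); apply: (tendsB hH); [exact: tends_cst hH _|exact: hl].
have lS : l \in square_summable.
  have [N hN] := fatou 1 ltr01.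
  rewrite (_ : l = (u N : nat -> H) - ((u N : nat -> H) - l)); last first.
    by rewrite opprB addrC subrK.
  rewrite rpredB //; first by case: (u N).
  by apply/asboolP; exists 1; exact: hN.
exists (L2 lS); apply: le_null => e /fatou[N hN]; exists N => k Nk.
rewrite ger0_norm; first by apply: l2_bound; exact: hN.
by apply: le_trans (l2_coord _ 0); exact: nsq_ge0.
Qed.

Definition lift2 (f : nat -> H) : l2 := insubd (0 : l2) f.

Lemma lift2E f n : f \in square_summable -> lift2 f n = f n.
Proof. by move=> fS; rewrite /lift2 -[l2val _]/(val _) insubdK. Qed.

Definition amplify (x : H -> H) (u : l2) : l2 := lift2 (fun n => x (u n)).

Definition single (j : nat) (w : H) : l2 :=
  lift2 (fun n => if n == j then w else 0).

Lemma amplifyE x c u n : op_bound ip x c -> amplify x u n = x (u n).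
Proof.
move=> [c0 xc]; rewrite lift2E //; apply/asboolP; exists (c * q2 u) => N.
apply: (@le_trans _ _ (c * series (fun n => nsq (u n)) N)).
  by rewrite /series /= mulr_sumr; apply: ler_sum.
by apply: ler_wpM2l => //; exact: l2_partial.
Qed.

Lemma amplify_bound x c u : op_bound ip x c -> q2 (amplify x u) <= c * q2 u.
Proof.
move=> xc; apply: l2_bound => N; have [c0 xb] := xc.
apply: (@le_trans _ _ (c * series (fun n => nsq (u n)) N)).
  rewrite /series /= mulr_sumr; apply: ler_sum => n _.
  by rewrite (amplifyE _ _ xc).
by apply: ler_wpM2l => //; exact: l2_partial.
Qed.

Lemma amplifyB x c : complex_linear x -> op_bound ip x c ->
  {morph amplify x : u v / u - v}.
Proof.
move=> xl xc u v; apply: l2_ext => n.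
by rewrite l2B !(amplifyE _ _ xc) l2B opB.
Qed.

Lemma singleE j w n : single j w n = if n == j then w else 0.
Proof.
rewrite lift2E //; apply/asboolP; exists (nsq w) => N; rewrite /series /=.
rewrite big_mkord; have [jN|Nj] := ltnP j N.
  rewrite (bigD1 (Ordinal jN)) //= eqxx big1 ?addr0 // => i ij.
  by rewrite -val_eqE /= in ij; rewrite (negPf ij) nsq0.
rewrite big1 ?nsq_ge0 // => i _.
by rewrite (ltn_eqF (leq_trans (ltn_ord i) Nj)) nsq0.
Qed.

Lemma single_q j w : q2 (single j w) <= nsq w.
Proof.
apply: l2_bound => N; rewrite /series /=.
rewrite big_mkord; have [jN|Nj] := ltnP j N.
  rewrite (bigD1 (Ordinal jN)) //= singleE eqxx big1 ?addr0 // => i ij.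
  rewrite -val_eqE /= in ij; by rewrite singleE (negPf ij) nsq0.
rewrite big1 ?nsq_ge0 // => i _.
by rewrite singleE (ltn_eqF (leq_trans (ltn_ord i) Nj)) nsq0.
Qed.

Lemma amplify_single x c j w : complex_linear x -> op_bound ip x c ->
  amplify x (single j w) = single j (x w).
Proof.
move=> xl xc; apply: l2_ext => n; rewrite (amplifyE _ _ xc) !singleE.
by case: eqP => // _; rewrite op0.
Qed.

Lemma tends_truncation (u : l2) :
  tends rl2 (fun N => \sum_(j < N) single j (u j)) u.
Proof.
have tE N n : (\sum_(j < N) single j (u j)) n = if (n < N)%N then u n else 0.
  elim: N => [|N IH]; first by rewrite big_ord0.
  rewrite big_ord_recr l2D IH singleE ltnS /=.
  by case: ltngtP => [||->]; rewrite ?addr0 ?add0r.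
apply: (@null_squeeze _ _ (fun N => q2 u - series (fun n => nsq (u n)) N)).
  move=> N; set d := _ - u.
  have dE n : d n = if (n < N)%N then 0 else - u n.
    by rewrite l2B tE; case: ltnP; rewrite ?subrr ?sub0r.
  clearbody d; rewrite (form_ge0 rl2_hilbert) /=; apply: l2_bound => M.
  rewrite lerBrDl; apply: le_trans (l2_partial u (N + M)).
  rewrite /series /= (@big_cat_nat _ _ _ N 0 (N + M)) ?leq_addr //= lerD2l.
  have [MN|NM] := leqP M N.
    rewrite big_nat_cond big1 => [|n]; last first.
      rewrite andbT => /andP[_ nM].
      by rewrite dE (leq_trans nM MN) (form_zero hH).
    by apply: sumr_ge0 => n _; exact: nsq_ge0.
  rewrite (@big_cat_nat _ _ _ N 0 M) ?(ltnW NM) //=.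
  rewrite big_nat_cond big1 => [|n]; last first.
    rewrite andbT => /andP[_ nN].
    by rewrite dE nN (form_zero hH).
  rewrite add0r (@big_cat_nat _ _ _ M N (N + M)) ?leq_addl ?(ltnW NM) //=.
  rewrite -[leLHS]addr0; apply: lerD.
    rewrite !big_nat; apply: ler_sum => n /andP[Nn _].
    by rewrite dE ltnNge Nn /= (form_opp hH) (form_oppr hH) opprK.
  by apply: sumr_ge0 => n _; exact: nsq_ge0.
rewrite -(subrr (q2 u)); apply: cvgB; first exact: cvg_cst.
exact: l2_nsq_cvg.
Qed.

End SquareSummable.

(** * Adjoints, commutants and the bicommutant *)

Section Operators.
Variables (R : realType) (H : completeNormedModType R[i]).
Variable ip : {dot H for @Num.conj R[i]}.
Hypothesis ip_norm : induces_norm ip.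
Local Notation rip := (real_ip ip).
Local Notation nsq v := (rip v v).
Local Notation hH := (real_ip_hilbert ip_norm).
Local Notation adjoint := (adjoint ip).
Implicit Types (S M : set (H -> H)) (x y : H -> H).

Lemma ip_inj_r (a b : H) : (forall u, ip u a = ip u b) -> a = b.
Proof.
move=> h; apply/eqP; rewrite -subr_eq0; apply/eqP/(form_eq0 hH).
by rewrite (form_subr hH) /real_ip h subrr.
Qed.

Lemma real_ip_ip x y : complex_linear x ->
  (forall u v, rip (x u) v = rip u (y v)) -> adjoint x y.
Proof.
move=> xl h u v; apply: complex_eq; first exact: h.
by rewrite -!ipZl -(opZ _ _ xl); exact: h.
Qed.

Lemma adjointC x y : adjoint x y -> adjoint y x.
Proof. by move=> h u v; rewrite ipC -h -ipC. Qed.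

Lemma adjoint_unique x y z : adjoint x y -> adjoint x z -> y = z.
Proof.
by move=> xy xz; apply/funext => v; apply: ip_inj_r => u; rewrite -xy xz.
Qed.

Lemma adjoint_rip x y u v : adjoint x y -> rip (x u) v = rip u (y v).
Proof. by move=> h; rewrite /real_ip h. Qed.

Lemma adjoint_comp x x' y y' : adjoint x x' -> adjoint y y' ->
  adjoint (x \o y) (y' \o x').
Proof. by move=> hx hy u v /=; rewrite hx hy. Qed.

Lemma adjoint_lin a x x' y y' : adjoint x x' -> adjoint y y' ->
  adjoint (a *: x + y) (Num.conj a *: x' + y').
Proof.
move=> hx hy u v; rewrite -[(a *: x + y) u]/(a *: x u + y u).
rewrite -[(_ *: x' + y') v]/(Num.conj a *: x' v + y' v).
by rewrite ipDl ipZl hx hy ipDr ipZr conjCK.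
Qed.

Lemma adjoint_linear x y : adjoint x y -> complex_linear y.
Proof.
by move=> h a u v; apply: ip_inj_r => w; rewrite -h !ipDr !ipZr !h.
Qed.

Lemma adjoint_bound x y c : adjoint x y -> op_bound ip x c -> op_bound ip y c.
Proof.
move=> h [c0 xc]; split=> // v.
have y0 := form_ge0 hH (y v); have v0 := form_ge0 hH v.
have [->|yv] := eqVneq (nsq (y v)) 0; first exact: mulr_ge0.
have yp : 0 < nsq (y v) by rewrite lt_def yv.
rewrite -(ler_pM2l yp) -expr2 {1}(_ : nsq (y v) = rip (x (y v)) v); last first.
  by rewrite (adjoint_rip _ _ h).
apply: (le_trans (form_CS hH _ _)); rewrite mulrCA mulrA.
by apply: ler_wpM2r.
Qed.

(** Riesz representation of u -> Re <x u, v> for each v. *)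
Lemma adjoint_exists x : bounded_op x -> exists2 y, bounded_op y & adjoint x y.
Proof.
move=> /(bounded_opP ip_norm)[xl [c [c0 xc]]].
have /choice[y hy] : forall v, exists z, forall u, rip u z = rip (x u) v.
  move=> v.
  have [|||||z _ hz] := @riesz _ _ rip hH H setT id (fun u => rip (x u) v)
      ((c + 1) * nsq v).
  - by [].
  - by [].
  - by [].
  - by move=> a u w _ _; rewrite (opD _ _ xl) (opZ _ _ xl) (form_add hH)
      (form_scale hH).
  - move=> u _; have := form_ge0 hH (x u - (c + 1)%:C *: v).
    rewrite (form_qB hH) (form_qZ hH) (form_scaler hH).
    have := xc u; have := form_ge0 hH u.
    set A := nsq u; set B := nsq (x u); set D := nsq v; set E := rip (x u) v.
    move=> A0 BA h; have c1 : 0 < c + 1 by lra.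
    rewrite -(ler_pM2l c1).
    have : (c + 1) * A = c * A + A by ring.
    nra.
  by exists z => u; rewrite hz.
have hxy : adjoint x y by apply: real_ip_ip => // u v; rewrite hy.
exists y => //; apply/(bounded_opP ip_norm); split; first exact: adjoint_linear hxy.
by exists c; apply: adjoint_bound hxy _.
Qed.

Lemma bounded_id : bounded_op (idfun : H -> H).
Proof.
apply/(bounded_opP ip_norm); split => //; exists 1; split => // v.
by rewrite mul1r.
Qed.

Lemma op_bound_comp x y c d : op_bound ip x c -> op_bound ip y d ->
  op_bound ip (x \o y) (c * d).
Proof.
move=> [c0 xc] [d0 yd]; split; first exact: mulr_ge0.
move=> v /=; apply: (le_trans (xc _)); rewrite -mulrA.
exact: ler_wpM2l.
Qed.

Lemma bounded_comp x y : bounded_op x -> bounded_op y -> bounded_op (x \o y).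
Proof.
move=> /(bounded_opP ip_norm)[xl [c xc]] /(bounded_opP ip_norm)[yl [d yd]].
apply/(bounded_opP ip_norm); split; first by move=> a u v /=; rewrite yl xl.
by exists (c * d); exact: op_bound_comp.
Qed.

Lemma op_bound_lin a x y c d : op_bound ip x c -> op_bound ip y d ->
  op_bound ip (a *: x + y) (2 * (Re (`|a| ^+ 2) * c + d)).
Proof.
move=> [c0 xc] [d0 yd].
have a0 : 0 <= Re (`|a| ^+ 2) by have [] := Re_ge0 (exprn_ge0 2 (normr_ge0 a)).
split; first by rewrite mulr_ge0 // addr_ge0 // mulr_ge0.
move=> v; rewrite -[(a *: x + y) v]/(a *: x v + y v).
apply: (le_trans (nsqD_le _ _ _)); rewrite nsqZ.
set A := Re _ in a0 *.
have -> : 2 * (A * c + d) * nsq v = 2 * (A * (c * nsq v) + d * nsq v) by ring.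
by apply: ler_wpM2l => //; apply: lerD => //; exact: ler_wpM2l.
Qed.

Lemma bounded_lin a x y : bounded_op x -> bounded_op y ->
  bounded_op (a *: x + y).
Proof.
move=> /(bounded_opP ip_norm)[xl [c xc]] /(bounded_opP ip_norm)[yl [d yd]].
apply/(bounded_opP ip_norm); split; last first.
  by eexists; exact: op_bound_lin xc yd.
move=> b u v; rewrite -![(a *: x + y) _]/(a *: x _ + y _) xl yl.
by rewrite !scalerDr !scalerA [b * a]mulrC addrACA.
Qed.

(** The algebraic part of being a von Neumann algebra: fixed points have it by
    inspection, and the bicommutant theorem needs no more. *)
Definition star_algebra M : Prop :=
  [/\ M `<=` @bounded_op R H, M idfun,
      forall a x y, M x -> M y -> M (a *: x + y),
      forall x y, M x -> M y -> M (x \o y)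
    & forall x, M x -> exists2 y, M y & adjoint x y].

Lemma commutant_id S : S `<=` @bounded_op R H -> commutant S idfun.
Proof. by move=> _; split=> //; exact: bounded_id. Qed.

Lemma commutant_lin S a x y : S `<=` @bounded_op R H ->
  commutant S x -> commutant S y -> commutant S (a *: x + y).
Proof.
move=> Sb [xb hx] [yb hy]; split; first exact: bounded_lin.
move=> z Sz; have [zl _] := Sb z Sz; apply/funext => v.
rewrite -[LHS]/(z (a *: x v + y v)) -[RHS]/(a *: x (z v) + y (z v)) zl.
have := congr1 (fun f => f v) (hx z Sz); rewrite /= => ->.
by have := congr1 (fun f => f v) (hy z Sz); rewrite /= => ->.
Qed.

Lemma commutant_comp S x y : commutant S x -> commutant S y ->
  commutant S (x \o y).
Proof.
move=> [xb hx] [yb hy]; split; first exact: bounded_comp.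
by move=> z Sz; rewrite compA hx // -compA hy.
Qed.

Lemma commutant_adjoint S x y : (forall z, S z -> exists2 w, S w & adjoint z w) ->
  commutant S x -> adjoint x y -> commutant S y.
Proof.
move=> Sadj [xb hx] xy; split.
  by have [z zb xz] := adjoint_exists xb; rewrite (adjoint_unique xy xz).
move=> z Sz; have [w Sw zw] := Sadj z Sz.
have h1 := adjoint_comp xy (adjointC zw); have h2 := adjoint_comp (adjointC zw) xy.
by rewrite (hx w Sw) in h2; exact: adjoint_unique h1 h2.
Qed.

Lemma bicommutant_sub M : M `<=` @bounded_op R H -> M `<=` commutant (commutant M).
Proof.
by move=> Mb x Mx; split; [exact: Mb|move=> y [_ hy]; rewrite hy].
Qed.

Lemma vN_star_algebra M : von_neumann_algebra ip M -> star_algebra M.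
Proof.
move=> [Mb Madj M2].
have cb : commutant M `<=` @bounded_op R H by move=> x [].
split=> //.
- by rewrite -M2; exact: commutant_id.
- by move=> a x y; rewrite -M2; exact: commutant_lin.
- by move=> x y; rewrite -M2; exact: commutant_comp.
Qed.

Local Notation q2 u := (rl2 u u).
Local Notation hL := (rl2_hilbert ip_norm).

Lemma amplify_adjoint x y c (u v : l2 ip) : adjoint x y -> op_bound ip x c ->
  rl2 (amplify x u) v = rl2 u (amplify y v).
Proof.
move=> xy xc; have yc := adjoint_bound xy xc.
congr (limn _); apply/funext => N; rewrite /series /=; apply: eq_bigr => n _.
by rewrite (amplifyE _ _ xc) // (amplifyE _ _ yc) // (adjoint_rip _ _ xy).
Qed.

Lemma amplify_lin a x y c d (u : l2 ip) : op_bound ip x c -> op_bound ip y d ->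
  amplify (a *: x + y) u = a *: amplify x u + amplify y u.
Proof.
move=> xc yd; apply: l2_ext => n.
rewrite l2D l2Z (amplifyE _ _ xc) (amplifyE _ _ yd).
by rewrite (amplifyE _ _ (op_bound_lin a xc yd)).
Qed.

Lemma amplify_comp x y c d (u : l2 ip) : op_bound ip x c -> op_bound ip y d ->
  amplify (x \o y) u = amplify x (amplify y u).
Proof.
move=> xc yd; apply: l2_ext => n.
rewrite (amplifyE _ _ xc) (amplifyE _ _ yd).
by rewrite (amplifyE _ _ (op_bound_comp xc yd)).
Qed.

Lemma amplify_id (u : l2 ip) : amplify idfun u = u.
Proof.
apply: l2_ext => n; rewrite (@amplifyE _ _ _ _ 1) //.
by split=> // v; rewrite mul1r.
Qed.

Lemma single_lin j a v w :
  single ip j (a *: v + w) = a *: single ip j v + single ip j w.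
Proof.
apply: l2_ext => n; rewrite l2D l2Z !singleE.
by case: ifP => // _; rewrite scaler0 addr0.
Qed.

(** The bicommutant theorem: the matrix entries of the projection of the
    amplified space onto the closure of M theta commute with M, hence with x,
    and this forces x theta into that closure. *)
Lemma bicommutant_approx M x (theta : l2 ip) : star_algebra M ->
  commutant (commutant M) x -> forall e : R, 0 < e ->
  exists2 m, M m & q2 (amplify x theta - amplify m theta) <= e.
Proof.
move=> [Mb M1 ML MC Madj] [xb hx].
have Mop m : M m -> complex_linear m /\ exists c, op_bound ip m c.
  by move/Mb/(bounded_opP ip_norm).
have M0 : M 0 by have := ML (-1) _ _ M1 M1; rewrite scaleN1r addNr.
have MZ a : M (a *: idfun) by have := ML a _ _ M1 M0; rewrite addr0.
pose L := [set amplify m theta | m in M].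
have Lsub : real_subspace L.
  split; first by exists 0 => //; apply: l2_ext => n; rewrite (@amplifyE _ _ _ _ 0) //;
    split=> // v; rewrite mul0r (form_zero hH).
  move=> a _ _ [m Mm <-] [k Mk <-]; exists (a%:C *: m + k); first exact: ML.
  have [_ [c mc]] := Mop m Mm; have [_ [d kd]] := Mop k Mk.
  exact: amplify_lin mc kd.
have [P hP] := proj_exists hL Lsub.
have PB := proj_additive hL Lsub hP.
have Pamp m u : M m -> P (amplify m u) = amplify m (P u).
  move=> Mm; have [m' Mm' mm'] := Madj m Mm.
  have [ml [c mc]] := Mop m Mm; have [_ [c' mc']] := Mop m' Mm'.
  have LM k d : M k -> op_bound ip k d -> forall l, L l -> L (amplify k l).
    move=> Mk kd _ [k' Mk' <-]; exists (k \o k'); first exact: MC.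
    by have [_ [d' kd']] := Mop k' Mk'; rewrite (amplify_comp _ kd kd').
  apply: (@proj_commute _ _ _ hL L P (amplify m) (amplify m') c u hP).
  - exact: amplifyB mc.
  - by move=> w; exact: amplify_bound.
  - by move=> v w; exact: amplify_adjoint mc.
  - exact: LM mc.
  - exact: LM mc'.
have PZ a u : P (a *: u) = a *: P u.
  have ac : op_bound ip (a *: idfun) (2 * (Re (`|a| ^+ 2) * 1 + 0)).
    have : op_bound ip (a *: idfun + 0) (2 * (Re (`|a| ^+ 2) * 1 + 0)).
      apply: op_bound_lin; split => // v; rewrite ?mul1r ?mul0r //.
      by rewrite (form_zero hH).
    by rewrite addr0.
  have aE v : amplify (a *: idfun) v = a *: v :> l2 ip.
    by apply: l2_ext => n; rewrite (amplifyE _ _ ac).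
  by rewrite -!aE Pamp.
have PN u : P (- u) = - P u by rewrite -scaleN1r PZ scaleN1r.
have PD u v : P (u + v) = P u + P v by rewrite -{1}[v]opprK PB PN opprK.
(* The matrix entries of P lie in the commutant of M, as P commutes with the
   amplification of M. *)
pose p i j w := P (single ip j w) i.
have pM i j : commutant M (p i j).
  split.
    apply/(bounded_opP ip_norm); split.
      by move=> a v w; rewrite /p single_lin PD PZ l2D l2Z.
    exists 1; split=> // w; rewrite mul1r; apply: (le_trans (l2_coord _ i)).
    by apply: le_trans (single_q ip j w); exact: (proj_contraction hL _ hP).
  move=> m Mm; apply/funext => w; have [ml [c mc]] := Mop m Mm.
  by rewrite /p /= -(amplify_single _ _ ml mc) Pamp // (amplifyE _ _ mc).
have [xl [c xc]] := iffLR (bounded_opP ip_norm x) xb.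
have Pxs j w : P (amplify x (single ip j w)) = amplify x (P (single ip j w)).
  apply: l2_ext => i; rewrite (amplifyE _ _ xc) (amplify_single _ _ xl xc).
  exact: (congr1 (fun f => f w) (hx _ (pM i j))).
have Px u : P (amplify x u) = amplify x (P u).
  have ampB := amplifyB xl xc.
  have Pc v : q2 (P v) <= 1 * q2 v by rewrite mul1r; exact: (proj_contraction hL _ hP).
  have xcb (v : l2 ip) : q2 (amplify x v) <= c * q2 v by exact: amplify_bound.
  have tu := tends_truncation ip_norm u.
  have t1 := tends_map hL PB Pc (tends_map hL ampB xcb tu).
  have t2 := tends_map hL ampB xcb (tends_map hL PB Pc tu).
  apply: (tends_unique hL t1); move: t2.
  set s1 := _ \o _; set s2 := _ \o _; suff -> : s1 = s2 by [].
  rewrite {}/s1 {}/s2; apply/funext => N /=.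
  have amp0 : amplify x 0 = 0 :> l2 ip by rewrite -{1}(subrr 0) ampB subrr.
  have ampD (v w : l2 ip) : amplify x (v + w) = amplify x v + amplify x w.
    by rewrite -{1}[w]opprK ampB -[- w]sub0r ampB amp0 sub0r opprK.
  have P0 : P 0 = 0 by rewrite -{1}(subrr 0) PB subrr.
  elim: N => [|N IH]; first by rewrite !big_ord0 P0 amp0 P0.
  by rewrite !big_ord_recr /= !(PD, ampD) IH Pxs.
have Ptheta : P theta = theta.
  by apply: (proj_id hL hP); exists idfun => //; rewrite amplify_id.
have [[u Lu utends] _] := hP (amplify x theta).
move=> e e0; have [N hN] := null_le utends e0.
have [m Mm mE] := Lu N; exists m => //.
have := hN N (leqnn N); rewrite -mE Px Ptheta ger0_norm ?(form_ge0 hL) //.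
by rewrite (form_qBC hL).
Qed.

End Operators.

(** * The braid shift *)

Section BraidShift.
Local Open Scope group_scope.

Lemma sigma_near j : (0 < j)%N ->
  sigma j * sigma j.+1 * sigma j = sigma j.+1 * sigma j * sigma j.+1.
Proof.
case: j => // j _; rewrite /sigma /= -![_ * _]/(braid_mul _ _) !braid_mulE.
by apply/braid_classP; apply: braid_near; right.
Qed.

Lemma sigma_far i j : (0 < i)%N -> (i.+1 < j)%N ->
  sigma i * sigma j = sigma j * sigma i.
Proof.
case: i => // i _; case: j => // j ij.
rewrite /sigma /= -![_ * _]/(braid_mul _ _) !braid_mulE.
by apply/braid_classP; apply: braid_far; left.
Qed.

Lemma gen_subgroupP (G : groupType) (S : set G) : subgroup (gen_subgroup S).
Proof.
split=> [C [[C1 _] _] //|x y hx hy C hC].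
by apply: (proj2 (proj1 hC)); [exact: hx|exact: hy].
Qed.

Lemma gen_subgroup_sub (G : groupType) (S C : set G) : subgroup C ->
  S `<=` C -> gen_subgroup S `<=` C.
Proof. by move=> *; exact: smallest_sub. Qed.

Lemma gen_subgroup_gen (G : groupType) (S : set G) : S `<=` gen_subgroup S.
Proof. by move=> x Sx C [_]; exact. Qed.

Lemma subgroupM (G : groupType) (K : set G) g h : subgroup K ->
  K g -> K h -> K (g * h).
Proof.
move=> [K1 KV] Kg Kh.
have Khi : K h^-1 by have := KV _ _ K1 Kh; rewrite mul1g.
by have := KV _ _ Kg Khi; rewrite invgK.
Qed.

Lemma conjugate_subgroup (G : groupType) (K : set G) h : subgroup K ->
  subgroup [set g | K (h^-1 * g * h)].
Proof.
move=> [K1 KV]; split=> [|g k /= hg hk]; first by rewrite /= mulg1 mulVg.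
have := KV _ _ hg hk; rewrite !invgM invgK !mulgA.
by rewrite -(mulgA _ h h^-1) mulgV mulg1.
Qed.

Lemma sigma_from n k : (0 < n)%N -> (n <= k)%N -> braid_from n (sigma k).
Proof.
move=> n0 nk; apply: gen_subgroup_gen; exists k => //.
by split=> //; exact: leq_trans nk.
Qed.

(** The word sigma_(n+k) ... sigma_(n+2) sigma_(n+1). *)
Fixpoint shift_word (n k : nat) : braid :=
  if k is k'.+1 then sigma (n + k) * shift_word n k' else 1.

Lemma shift_word_comm n k m : (n + k < m.-1)%N ->
  sigma m * shift_word n k = shift_word n k * sigma m.
Proof.
elim: k => [|k IH] h /=; first by rewrite mulg1 mul1g.
have h' : (n + k < m.-1)%N by apply: leq_ltn_trans h; rewrite leq_add2l.
rewrite mulgA -sigma_far; [|by rewrite addnS|by case: m h {IH h'}].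
by rewrite -!mulgA IH.
Qed.

(** sigma_j commutes with the factors to the left of sigma_(j+1), the braid
    relation turns it into sigma_(j+1), and this commutes with the factors to
    the right of sigma_j. *)
Lemma shift_word_sigma n k j : (n < j)%N -> (j < n + k)%N ->
  sigma j * shift_word n k = shift_word n k * sigma j.+1.
Proof.
elim: k => [|k IH] nj /=; first by rewrite addn0 ltnNge ltnW.
rewrite addnS ltnS leq_eqVlt => /predU1P[jE|jk].
  have j0 : (0 < j)%N by exact: leq_trans nj.
  case: k jE {IH} => [|k] jE; first by move: nj; rewrite jE addn0 ltnn.
  rewrite /= -jE !mulgA sigma_near // -!mulgA; congr (_ * (_ * _)).
  by apply: shift_word_comm; rewrite /= jE addnS.
rewrite mulgA sigma_far //; last exact: leq_trans nj.
by rewrite -!mulgA IH.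
Qed.

Lemma shift_word_factor n k : exists2 g, braid_from n.+2 g &
  shift_word n k.+1 = g * sigma n.+1.
Proof.
elim: k => [|k [g Kg gE]].
  exists 1; first by case: (gen_subgroupP (sigma @` [set k | (1 <= k)%N /\ (n.+2 <= k)%N])).
  by rewrite /= addn1 mulg1 mul1g.
exists (sigma (n + k.+2) * g); last by rewrite -mulgA -gE.
apply: (subgroupM (gen_subgroupP _)) => //.
by apply: sigma_from => //; rewrite !addnS ltnS ltnS leq_addr.
Qed.

End BraidShift.

(** * Vectors that control a faithful normal state *)

Section State.
Variables (R : realType) (H : completeNormedModType R[i]).
Variable ip : {dot H for @Num.conj R[i]}.
Hypothesis ip_norm : induces_norm ip.
Local Notation rip := (real_ip ip).
Local Notation nsq v := (rip v v).
Local Notation hH := (real_ip_hilbert ip_norm).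
Local Notation adjoint := (adjoint ip).
Local Notation q2 u := (rl2 u u).
Local Notation hL := (rl2_hilbert ip_norm).
Implicit Types (S M : set (H -> H)) (x y : H -> H).

(** The adjoint as a function on operators, with value idfun where there is no
    adjoint. *)
Definition star x : H -> H := xget (idfun : H -> H) [set y | adjoint x y].

Lemma starP x y : adjoint x y -> star x = y.
Proof.
move=> xy; have h : adjoint x (star x) by apply: (@xgetPex _ (idfun : H -> H) [set y | adjoint x y]); exists y.
exact: (adjoint_unique ip_norm h xy).
Qed.

Variables (A : set (H -> H)) (phi : (H -> H) -> R[i]).
Hypothesis A_phi : probability_space ip A phi.

Let A_vN : von_neumann_algebra ip A. Proof. by case: A_phi. Qed.
Let A_alg : star_algebra ip A. Proof. exact: vN_star_algebra. Qed.

Lemma alg1 : A idfun. Proof. by case: A_alg. Qed.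
Lemma alg_lin a x y : A x -> A y -> A (a *: x + y).
Proof. by case: A_alg => _ _ h _ _; exact: h. Qed.
Lemma algM x y : A x -> A y -> A (x \o y).
Proof. by case: A_alg => _ _ _ h _; exact: h. Qed.
Lemma alg_star x : A x -> A (star x) /\ adjoint x (star x).
Proof.
by case: A_alg => _ _ _ _ h /h[y Ay xy]; rewrite (starP xy).
Qed.
Lemma alg0 : A 0.
Proof. by have := alg_lin (-1) alg1 alg1; rewrite scaleN1r addNr. Qed.
Lemma algZ a x : A x -> A (a *: x).
Proof. by move=> Ax; have := alg_lin a Ax alg0; rewrite addr0. Qed.
Lemma algD x y : A x -> A y -> A (x + y).
Proof. by move=> Ax Ay; have := alg_lin 1 Ax Ay; rewrite scale1r. Qed.
Lemma algB x y : A x -> A y -> A (x - y).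
Proof.
by move=> Ax Ay; have := alg_lin (-1) Ay Ax; rewrite scaleN1r addrC.
Qed.
Lemma alg_op x : A x -> complex_linear x /\ exists c, op_bound ip x c.
Proof. by case: A_alg => h _ _ _ _ /h/(bounded_opP ip_norm). Qed.

Lemma phi_lin a x y : A x -> A y -> phi (a *: x + y) = a * phi x + phi y.
Proof. by case: A_phi => _ _ [h _ _] _ _; exact: h. Qed.
Lemma phi1 : phi idfun = 1.
Proof. by case: A_phi => _ _ [_ _ h] _ _. Qed.
Lemma phi0 : phi 0 = 0.
Proof.
have := phi_lin 1 alg0 alg0; rewrite scale1r addr0 mul1r.
by move/(congr1 (fun z => z - phi 0)); rewrite subrr addrK.
Qed.
Lemma phiZ a x : A x -> phi (a *: x) = a * phi x.
Proof. by move=> Ax; have := phi_lin a Ax alg0; rewrite !addr0 phi0 addr0. Qed.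
Lemma phiB x y : A x -> A y -> phi (x - y) = phi x - phi y.
Proof.
move=> Ax Ay; have := phi_lin (-1) Ay Ax.
by rewrite scaleN1r mulN1r addrC => ->; rewrite addrC.
Qed.

(** The real part of the GNS inner product of A, and the square of its norm. *)
Definition fphi x y : R := Re (phi (star y \o x)).
Definition nphi x : R := fphi x x.

Lemma nphi_ge0 x : A x -> 0 <= nphi x.
Proof.
move=> Ax; have [_ xs] := alg_star Ax.
by case: A_phi => _ _ [_ h _] _ _; case: (Re_ge0 (h _ _ Ax xs)).
Qed.

Lemma nphi_eq0 x : A x -> nphi x = 0 -> x = 0.
Proof.
move=> Ax x0; have [_ xs] := alg_star Ax.
case: A_phi => _ _ [_ h _] _ hf; apply: (hf _ _ Ax xs).
by have [-> _] := Re_ge0 (h _ _ Ax xs); rewrite -/(fphi x x) -/(nphi x) x0.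
Qed.

Lemma fphi_lin (a : R) x x' y : A x -> A x' -> A y ->
  fphi (a%:C *: x + x') y = a * fphi x y + fphi x' y.
Proof.
move=> Ax Ax' Ay; have [Ays ys] := alg_star Ay.
have [yl _] := alg_op Ays.
have -> : fphi (a%:C *: x + x') y =
    Re (phi (a%:C *: (star y \o x) + (star y \o x'))).
  congr (Re (phi _)); apply/funext => v.
  by rewrite -[LHS]/(star y (a%:C *: x v + x' v)) yl.
by rewrite phi_lin ?ReD ?ReZ //; exact: algM.
Qed.

(** With z = i x + y, the imaginary part of phi (z* z) is the difference of the
    two sides, and it vanishes by positivity. *)
Lemma fphi_sym x y : A x -> A y -> fphi x y = fphi y x.
Proof.
move=> Ax Ay; have [Axs xs] := alg_star Ax; have [Ays ys] := alg_star Ay.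
have [xsl _] := alg_op Axs; have [ysl _] := alg_op Ays.
pose z := 'i%C *: x + y.
have Az : A z by exact: alg_lin.
have zs : adjoint z (Num.conj 'i%C *: star x + star y) by exact: adjoint_lin.
have [_ _ [_ h _] _ _] := A_phi.
have [hE _] := Re_ge0 (h _ _ Az zs).
have [xE _] := Re_ge0 (h _ _ Ax xs).
have [yE _] := Re_ge0 (h _ _ Ay ys).
have zE : phi ((Num.conj 'i%C *: star x + star y) \o z) =
    phi (star x \o x) - 'i%C * phi (star x \o y) + 'i%C * phi (star y \o x)
    + phi (star y \o y).
  have -> : (Num.conj 'i%C *: star x + star y) \o z =
      (star x \o x) + ((- 'i%C) *: (star x \o y) + ('i%C *: (star y \o x)
      + (star y \o y))).
    apply/funext => v.
    rewrite -[LHS]/(Num.conj 'i%C *: star x ('i%C *: x v + y v)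
      + star y ('i%C *: x v + y v)).
    rewrite -[RHS]/(star x (x v) + (- 'i%C *: star x (y v) +
      ('i%C *: star y (x v) + star y (y v)))).
    rewrite xsl ysl scalerDr scalerA.
    by rewrite conj_i mulNr -expr2 sqr_i opprK scale1r [RHS]addrA.
  have -> : (star x \o x) + ((- 'i%C) *: (star x \o y) + ('i%C *: (star y \o x)
      + (star y \o y))) = 1 *: (star x \o x) + ((- 'i%C) *: (star x \o y) + ('i%C *: (star y \o x)
      + (star y \o y))) by rewrite scale1r.
  have Axx := algM Axs Ax; have Axy := algM Axs Ay.
  have Ayx := algM Ays Ax; have Ayy := algM Ays Ay.
  have A1 := alg_lin 'i%C Ayx Ayy; have A2 := alg_lin (- 'i%C) Axy A1.
  rewrite (phi_lin _ Axx A2) (phi_lin _ Axy A1) (phi_lin _ Ayx Ayy).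
  by rewrite mul1r mulNr !addrA.
have := congr1 (@complex.Im R) hE; rewrite zE xE yE /fphi.
case: (phi (star x \o y)) => a b; case: (phi (star y \o x)) => c d /=.
lra.
Qed.

Lemma nphi_qD (a : R) x y : A x -> A y ->
  nphi (a%:C *: x + y) = a ^+ 2 * nphi x + 2 * a * fphi x y + nphi y.
Proof.
move=> Ax Ay; have Az := alg_lin a%:C Ax Ay.
rewrite /nphi fphi_lin // (fphi_sym Ax Az) (fphi_sym Ay Az) !fphi_lin //.
by rewrite (fphi_sym Ay Ax); ring.
Qed.

Lemma nphi_B x y : A x -> A y -> nphi (x - y) = nphi x - 2 * fphi x y + nphi y.
Proof.
move=> Ax Ay; have := nphi_qD (-1) Ay Ax.
by rewrite rmorphN rmorph1 scaleN1r addrC => ->; rewrite (fphi_sym Ay Ax); ring.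
Qed.

Lemma fphi_CS x y : A x -> A y -> fphi x y ^+ 2 <= nphi x * nphi y.
Proof.
move=> Ax Ay; have x0 := nphi_ge0 Ax; have y0 := nphi_ge0 Ay.
have key (a : R) : 0 <= a ^+ 2 * nphi x + 2 * a * fphi x y + nphi y.
  by rewrite -nphi_qD //; apply: nphi_ge0; exact: alg_lin.
have [xz|xp] := eqVneq (nphi x) 0.
  rewrite xz mul0r; have [->|fz] := eqVneq (fphi x y) 0; first by rewrite expr0n.
  have := key (- (nphi y + 1) / fphi x y); rewrite xz mulr0 add0r.
  rewrite -mulrA divfK //; lra.
have xp' : 0 < nphi x by rewrite lt_def xp.
have h := key (- (fphi x y / nphi x)).
rewrite -subr_ge0.
have -> : nphi x * nphi y - fphi x y ^+ 2 = nphi x *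
  ((- (fphi x y / nphi x)) ^+ 2 * nphi x + 2 * - (fphi x y / nphi x) * fphi x y + nphi y).
  by field.
exact: mulr_ge0.
Qed.

Lemma star_id : star idfun = idfun.
Proof. by apply: starP. Qed.

Lemma fphi1 x : fphi x idfun = Re (phi x).
Proof. by rewrite /fphi star_id. Qed.

Lemma nphi1 : nphi idfun = 1.
Proof. by rewrite /nphi fphi1 phi1. Qed.

(** Let xi and eta be the sequences that define phi as a normal functional. As
    Re <a, b> <= |(a + b) / 2|^2, the sequence (xi + eta) / 2 will do. *)
Lemma nphi_le_vector : exists theta : l2 ip,
  forall z, A z -> nphi z <= q2 (amplify z theta).
Proof.
have [_ _ _ [xi [eta [xic etac phiE]]] _] := A_phi.
have sq (f : nat -> H) : cvgn (series (fun n => `|f n| ^+ 2)) ->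
    f \in square_summable ip.
  move=> /cvg_ex[l /= /cvg_Re fl]; apply/asboolP.
  have fE N : Re (series (fun n => `|f n| ^+ 2) N) =
      series (fun n => nsq (f n)) N.
    rewrite /series /= Re_sum.
    by apply: eq_bigr => n _; rewrite (nsqE ip_norm).
  have {}fl : series (fun n => nsq (f n)) @ \oo --> Re l.
    by move: fl; rewrite (_ : (fun n => Re _) = series (fun n => nsq (f n))) //;
      apply/funext => N; rewrite fE.
  exists (Re l) => N; rewrite -(cvg_lim _ fl) //.
  apply: nondecreasing_cvgn_le; last by apply/cvg_ex; exists (Re l).
  by apply: series_nd => n; exact: nsq_ge0.
pose f : nat -> H := (2^-1)%:C *: (xi + eta).
have fS : f \in square_summable ip.
  have [h0 hD] := square_summable_closed ip.
  have := hD (2^-1)%:C _ _ (hD 1 _ _ (sq _ xic) (sq _ etac)) h0.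
  by rewrite scale1r addr0.
exists (lift2 ip f) => z Az; have [zl [c zc]] := alg_op Az.
have [Azs zs] := alg_star Az.
have /cvg_Re h := phiE _ (algM Azs Az).
apply: (@cvgr_to_le _ _ _ _ _ _ _ h); apply: nearW => N.
apply: le_trans (l2_partial _ N).
rewrite /series /= Re_sum; apply: ler_sum => n _.
rewrite (amplifyE _ _ zc) lift2E // -[f n]/((2^-1)%:C *: (xi n + eta n)).
rewrite (opZ _ _ zl) (opD _ _ zl) (form_qZ hH) (form_qD hH).
rewrite -[Re _]/(rip (star z (z (xi n))) (eta n)).
rewrite (adjoint_rip _ _ (adjointC zs)).
have := form_ge0 hH (z (xi n) - z (eta n)); rewrite (form_qB hH); lra.
Qed.

(** The vector zeta represents phi on the closure of A theta:
    Re (phi z) = Re <z theta, zeta> for z in A. Then x zeta represents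
    b -> phi (x* b); its norm is bounded by the GNS norm of x, because
    |phi (x* b)| is at most the product of the GNS norms of x and b, and it
    vanishes only if phi (x* x) does. *)
Lemma separating_vector : exists zeta : nat -> H,
  (forall x n, A x -> nsq (x (zeta n)) <= nphi x) /\
  (forall x, A x -> (forall n, x (zeta n) = 0) -> x = 0).
Proof.
have [theta htheta] := nphi_le_vector.
have [|||||zeta [u Au uz] hz] := @riesz _ _ _ hL (H -> H) A
    (fun z => amplify z theta) (fun z => Re (phi z)) 1.
- exact: alg0.
- by move=> a x y; exact: alg_lin.
- move=> a x y Ax Ay; have [_ [c xc]] := alg_op Ax; have [_ [d yd]] := alg_op Ay.
  exact: amplify_lin xc yd.
- by move=> a x y Ax Ay; rewrite phi_lin // ReD ReZ.
- move=> x Ax; have := nphi_ge0 (algB Ax alg1).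
  rewrite nphi_B //; last exact: alg1.
  by rewrite fphi1 nphi1; have := htheta x Ax; lra.
have pair x b : A x -> A b -> rl2 (amplify b theta) (amplify x zeta) = fphi b x.
  move=> Ax Ab; have [Axs xs] := alg_star Ax.
  have [_ [c xc]] := alg_op Ax; have [_ [d bd]] := alg_op Ab.
  rewrite -(amplify_adjoint ip_norm _ _ (adjointC xs) (adjoint_bound ip_norm xs xc)).
  rewrite -(amplify_comp _ (adjoint_bound ip_norm xs xc) bd).
  by rewrite hz //; exact: algM.
exists zeta; split=> [x n Ax|x Ax x0].
  have [xl [c xc]] := alg_op Ax.
  rewrite -(amplifyE _ _ xc); apply: le_trans (l2_coord _ n) _.
  have t : tends (@rl2 R H ip) (fun k => amplify (x \o u k) theta) (amplify x zeta).
    have := tends_map hL (amplifyB xl xc) (fun v => amplify_bound v xc) uz.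
    set s1 := _ \o _; set s2 := (fun k => _); suff -> : s1 = s2 by [].
    apply/funext => k; rewrite {}/s1 {}/s2 /=; have [_ [d ud]] := alg_op (Au k).
    by rewrite (amplify_comp _ xc ud).
  pose b k := amplify (x \o u k) theta.
  have h : (fun k => 2 * rl2 (b k) (amplify x zeta) - q2 (b k)) @ \oo -->
      2 * q2 (amplify x zeta) - q2 (amplify x zeta).
    apply: cvgB; last exact: (tends_q hL t).
    by apply: cvgM; [exact: cvg_cst|exact: (tends_form hL t)].
  rewrite (_ : q2 _ = 2 * q2 (amplify x zeta) - q2 (amplify x zeta)); last by ring.
  apply: (@cvgr_to_le _ _ _ _ _ _ _ h); apply: nearW => k; rewrite /b.
  have Axu : A (x \o u k) by exact: algM.
  rewrite pair //; have := htheta _ Axu; have := nphi_ge0 (algB Axu Ax).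
  by rewrite nphi_B //; lra.
apply: nphi_eq0 => //; rewrite /nphi -pair //.
have [_ [c xc]] := alg_op Ax.
have -> : amplify x zeta = 0.
  by apply: l2_ext => n; rewrite (amplifyE _ _ xc) x0.
exact: form_zeror hL _.
Qed.

(** The span is defined as the least subspace, so that what holds on it is
    proved by induction. *)
Definition commutant_span (zeta : nat -> H) : set H :=
  smallest (@real_subspace R H)
    [set v | exists b n, commutant A b /\ v = b (zeta n)].

Lemma commutant_span_sub zeta (B : set H) : real_subspace B ->
  (forall b n, commutant A b -> B (b (zeta n))) -> commutant_span zeta `<=` B.
Proof.
move=> hB h; apply: smallest_sub => // v [b [n [bA ->]]]; exact: h.
Qed.

Lemma commutant_span_subspace zeta : real_subspace (commutant_span zeta).
Proof.
split; first by move=> B [[B0 _] _].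
move=> a x y hx hy B BB; case: (BB) => -[_ BL] _.
by apply: BL; [exact: hx|exact: hy].
Qed.

Lemma commutant_span_gen zeta b n : commutant A b ->
  commutant_span zeta (b (zeta n)).
Proof. by move=> bA B [_ h]; apply: h; exists b, n. Qed.

Lemma alg_bounded : A `<=` @bounded_op R H.
Proof. by case: A_alg. Qed.

Lemma commutant_op b : commutant A b -> complex_linear b /\ exists c, op_bound ip b c.
Proof. by case=> /(bounded_opP ip_norm). Qed.

Lemma bicommutant_alg x : commutant (commutant A) x -> A x.
Proof. by case: A_vN => _ _ {2}<-. Qed.

Lemma subtractive_linear (f : H -> H) : {morph f : u v / u - v} ->
  (forall a u, f (a *: u) = a *: f u) -> complex_linear f.
Proof.
move=> fB fZ a u v; rewrite -[in LHS](opprK v) fB fZ -(scaleN1r v) fZ.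
by rewrite scaleN1r opprK.
Qed.

Lemma commutant_scalar a : commutant A (a *: idfun).
Proof.
have id1 := commutant_id ip_norm alg_bounded.
have := commutant_lin ip_norm (a - 1) alg_bounded id1 id1.
by rewrite -{2}[idfun]scale1r -scalerDl subrK.
Qed.

(** The projection onto the closed span commutes with the commutant, so it
    lies in A; its complement kills every separating vector. *)
Lemma commutant_span_dense zeta v :
  (forall x, A x -> (forall n, x (zeta n) = 0) -> x = 0) ->
  adherent rip (commutant_span zeta) v.
Proof.
move=> sep; set L := commutant_span zeta.
have Lsub : real_subspace L := commutant_span_subspace zeta.
have [P hP] := proj_exists hH Lsub.
have LM b : commutant A b -> forall l, L l -> L (b l).
  move=> bA; have [bl _] := commutant_op bA.
  apply: commutant_span_sub.
    split; first by rewrite /= op0 //; case: Lsub.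
    by move=> a x y Lx Ly /=; rewrite bl; apply: (proj2 Lsub).
  move=> b' n b'A; apply: (@commutant_span_gen _ (b \o b')).
  exact: (commutant_comp ip_norm).
have comm b u : commutant A b -> P (b u) = b (P u).
  move=> bA; have [bl [c bc]] := commutant_op bA.
  have [bop _] := bA; have [b' _ bb'] := adjoint_exists ip_norm bop.
  have b'A : commutant A b'.
    by apply: (commutant_adjoint ip_norm _ bA bb'); case: A_alg.
  apply: (@proj_commute _ _ _ hH L P b b' c u hP).
  - by move=> x y; exact: opB.
  - by case: bc.
  - by move=> x y; exact: adjoint_rip.
  - exact: LM.
  - exact: LM.
have PB := proj_additive hH Lsub hP.
have PZ a u : P (a *: u) = a *: P u by exact: comm (commutant_scalar a).
have PA : A P.
  apply: bicommutant_alg; split; last by move=> b bA; apply/funext => u /=; rewrite comm.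
  apply/(bounded_opP ip_norm); split; first exact: subtractive_linear.
  by exists 1; split=> // u; rewrite mul1r; exact: (proj_contraction hH _ hP).
have : idfun - P = 0.
  apply: sep; first exact: (algB alg1 PA).
  move=> n; rewrite -[LHS]/(zeta n - P (zeta n)) (proj_id hH hP) ?subrr //.
  apply: (@commutant_span_gen _ idfun); exact: (commutant_id ip_norm alg_bounded).
move=> /(congr1 (fun f => f v)); rewrite -[LHS]/(v - P v) -[RHS]/0.
move=> /eqP; rewrite subr_eq0 => /eqP ->.
by have [] := hP v.
Qed.

(** By the quadratic inequality the ratios of consecutive terms are nondecreasing,
    so a first ratio above d would make b outgrow C * d ^ m. *)
Lemma log_convex_ratio (b : nat -> R) (C d : R) : 0 <= d ->
  (forall m, 0 <= b m) -> (forall m, b m.+1 ^+ 2 <= b m * b m.+2) ->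
  (forall m, b m <= C * d ^+ m) -> b 1%N <= d * b 0%N.
Proof.
move=> d0 b0 conv hC; rewrite leNgt; apply/negP => lt1.
have b1 : 0 < b 1%N by apply: le_lt_trans lt1; exact: mulr_ge0.
have b00 : 0 < b 0%N.
  rewrite lt_def b0 andbT; apply/eqP => z; have := conv 0%N.
  by rewrite z mul0r leNgt exprn_gt0.
pose s := b 1%N / b 0%N.
have s0 : 0 < s by rewrite divr_gt0.
have ds : d < s by rewrite ltr_pdivlMr.
have step m : 0 < b m /\ s * b m <= b m.+1.
  elim: m => [|m [bm IH]]; first by rewrite /s divfK ?gt_eqF.
  have bm1 : 0 < b m.+1 by apply: lt_le_trans IH; exact: mulr_gt0.
  split=> //; rewrite -(ler_pM2l bm); apply: le_trans (conv m).
  rewrite (_ : b m * (s * b m.+1) = s * b m * b m.+1); last by ring.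
  by rewrite expr2 ler_pM2r.
have grow m : s ^+ m * b 0%N <= b m.
  elim: m => [|m IH]; first by rewrite expr0 mul1r.
  have [_ h] := step m; apply: le_trans h; rewrite exprS -mulrA.
  by rewrite ler_pM2l.
have q0 : 0 <= d / s by rewrite divr_ge0 // ltW.
have q1 : `|d / s| < 1 by rewrite ger0_norm // ltr_pdivrMr // mul1r.
have := cvg_expr q1 => /(cvgM (cvg_cst C)); rewrite mulr0 => /cvgrPdist_lt.
move=> /(_ _ b00)[N _ /(_ N (leqnn N))]; rewrite /= sub0r normrN.
have : b 0%N <= C * (d / s) ^+ N.
  rewrite expr_div_n mulrA ler_pdivlMr ?exprn_gt0 //.
  by rewrite mulrC; apply: le_trans (grow N) (hC N).
move=> h h'; have := lt_le_trans h' (le_trans h (ler_norm _)).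
by rewrite ltxx.
Qed.

Lemma automorphism_nphi alpha x : automorphism ip A alpha ->
  (forall y, A y -> phi (alpha y) = phi y) -> A x -> nphi (alpha x) = nphi x.
Proof.
move=> [_ _ aM aadj] aphi Ax; have [Axs xs] := alg_star Ax.
rewrite /nphi /fphi (starP (aadj _ _ Ax xs)) -aM // aphi //.
exact: algM.
Qed.

Lemma automorphism_id alpha : automorphism ip A alpha -> alpha idfun = idfun.
Proof.
move=> [[_ _ asurj] _ aM _]; have [z Az z1] := asurj _ alg1.
have h : alpha z = alpha z \o alpha idfun := aM _ _ Az alg1.
by rewrite z1 in h; exact: esym h.
Qed.

Lemma automorphism_alg alpha x : automorphism ip A alpha -> A x -> A (alpha x).
Proof. by move=> [[h _ _] _ _ _]; exact: h. Qed.

Definition op_power x m : H -> H := iter m (fun y => x \o y) idfun.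

Lemma op_power_bound x c m : op_bound ip x c -> op_bound ip (op_power x m) (c ^+ m).
Proof.
move=> xc; elim: m => [|m IH]; first by split=> // v; rewrite expr0 mul1r.
by rewrite exprS; exact: op_bound_comp.
Qed.

(** Put T = alpha (x* x). For u in the commutant span, |T^m u|^2 is at most a
    constant, depending on u, times the square of the GNS norm of (x* x)^m,
    because alpha preserves phi; so it is at most a constant times c^(2 m). As
    T is self-adjoint, these numbers are log-convex in m, which removes the
    constant: |T u| <= c |u|. Density extends the bound to all vectors. *)
Lemma automorphism_bound alpha x c : automorphism ip A alpha ->
  (forall y, A y -> phi (alpha y) = phi y) -> A x -> op_bound ip x c ->
  op_bound ip (alpha x) c.
Proof.
move=> aut aphi Ax xc; have [c0 _] := xc; split=> //.
have [zeta [hz sep]] := separating_vector; have [theta htheta] := nphi_le_vector.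
have [_ _ aM aadj] := aut.
have [Axs xs] := alg_star Ax.
pose y := star x \o x; have Ay : A y by exact: algM.
have yc : op_bound ip y (c * c).
  by apply: op_bound_comp => //; exact: (adjoint_bound ip_norm xs).
pose T := alpha y; have AT : A T by exact: automorphism_alg.
have TE : T = alpha (star x) \o alpha x by exact: aM.
have axs := aadj _ _ Ax xs.
have Ts : adjoint T T by rewrite TE; apply: adjoint_comp => //; exact: adjointC.
have Apow z m : A z -> A (op_power z m).
  by move=> Az; elim: m => [|m IH]; [exact: alg1|exact: algM].
have apow m : alpha (op_power y m) = op_power T m.
  elim: m => [|m IH]; first exact: automorphism_id.
  by rewrite /= aM //; [rewrite IH|exact: Apow].
have Tm m n : nsq (op_power T m (zeta n)) <= q2 theta * (c * c) ^+ m.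
  apply: (le_trans (hz _ _ (Apow _ _ AT))).
  rewrite -apow automorphism_nphi //; last exact: Apow.
  apply: (le_trans (htheta _ (Apow _ _ Ay))); rewrite mulrC.
  exact/amplify_bound/op_power_bound.
have [Tl _] := alg_op AT.
have span : commutant_span zeta `<=`
    [set u | exists C, forall m, nsq (op_power T m u) <= C * (c * c) ^+ m].
  apply: commutant_span_sub.
    split; rewrite /=.
      exists 0 => m; have [pl _] := alg_op (Apow _ m AT).
      by rewrite op0 // nsq0 mul0r.
    move=> a u1 u2 [C1 h1] [C2 h2]; exists (2 * (a ^+ 2 * C1 + C2)) => m.
    have [pl _] := alg_op (Apow _ m AT); rewrite pl.
    apply: (le_trans (nsqD_le _ _ _)); rewrite (form_qZ hH).
    have := h1 m; have := h2 m; have := sqr_ge0 a.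
    set X := nsq _; set Y := nsq _; set D := (c * c) ^+ m => a0 hX hY.
    have := ler_wpM2l a0 hY; lra.
  move=> b n bA; have [bl [d [d0 bd]]] := commutant_op bA; have [_ bc] := bA.
  exists (d * q2 theta) => m.
  have -> : op_power T m (b (zeta n)) = b (op_power T m (zeta n)).
    exact: (congr1 (fun f => f (zeta n)) (bc _ (Apow _ m AT))).
  by apply: (le_trans (bd _)); rewrite -mulrA ler_wpM2l.
have onspan u : commutant_span zeta u -> nsq (alpha x u) <= c * nsq u.
  move=> /span[C hC].
  have := @log_convex_ratio (fun m => nsq (op_power T m u)) C (c * c)
    (mulr_ge0 c0 c0) (fun m => nsq_ge0 ip _) _ hC.
  have conv m : nsq (op_power T m.+1 u) ^+ 2 <=
      nsq (op_power T m u) * nsq (op_power T m.+2 u).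
    rewrite {1}(_ : nsq _ = rip (op_power T m u) (op_power T m.+2 u)).
      exact: form_CS hH _ _.
    by rewrite /= (adjoint_rip _ _ Ts).
  move=> /(_ conv) /= h.
  have E : nsq (alpha x u) = rip (T u) u.
    by rewrite TE /= (adjoint_rip _ _ (adjointC axs)).
  have := form_CS hH (T u) u; rewrite -E => h'.
  have u0 := nsq_ge0 ip u.
  rewrite -(@ler_pXn2r _ 2) ?nnegrE ?nsq_ge0 ?mulr_ge0 //.
  apply: (le_trans h'); rewrite expr2 mulrACA mulrA.
  by rewrite ler_wpM2r.
move=> v; have [u Lu uv] := commutant_span_dense v sep.
have Aax : A (alpha x) by exact: automorphism_alg.
have [al [d [_ ad]]] := alg_op Aax.
have t1 := tends_map hH (fun s t => opB s t al) ad uv.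
have t2 := tends_q hH uv.
apply: ler_cvg_to (tends_q hH t1) (cvgM (cvg_cst c) t2) _.
by apply: nearW => k; exact: onspan.
Qed.

(** Dominated convergence: the operators are uniformly bounded, so the tails of
    sum_n |z_k theta_n|^2 are small uniformly in k. *)
Lemma pointwise_null_nphi (z : nat -> H -> H) c : (forall k, A (z k)) ->
  (forall k, op_bound ip (z k) c) ->
  (forall v, tends rip (fun k => z k v) 0) ->
  (fun k => nphi (z k)) @ \oo --> (0 : R).
Proof.
move=> Az zc z0; have [theta htheta] := nphi_le_vector.
have [c0 _] := zc 0%N.
have tail N k : q2 (amplify (z k) theta) <=
    series (fun n => nsq (z k (theta n))) N
    + c * (q2 theta - series (fun n => nsq (theta n)) N).
  apply: l2_bound => M.
  apply: (@le_trans _ _ (series (fun n => nsq (z k (theta n))) (N + M))).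
    rewrite /series /= (eq_bigr (fun n => nsq (z k (theta n)))).
      rewrite (@big_cat_nat _ _ _ M 0 (N + M)) ?leq_addl //= lerDl.
      by apply: sumr_ge0 => n _; exact: nsq_ge0.
    by move=> n _; rewrite (amplifyE _ _ (zc k)).
  rewrite /series /= (@big_cat_nat _ _ _ N 0 (N + M)) ?leq_addr //= lerD2l.
  apply: (@le_trans _ _ (c * \sum_(N <= n < N + M) nsq (theta n))).
    by rewrite mulr_sumr; apply: ler_sum => n _; have [] := zc k.
  rewrite ler_wpM2l // lerBrDl.
  have := l2_partial theta (N + M).
  by rewrite /series /= (@big_cat_nat _ _ _ N 0 (N + M)) ?leq_addr.
have tl : (fun N => c * (q2 theta - series (fun n => nsq (theta n)) N)) @ \oo
    --> (0 : R).
  rewrite -(mulr0 c); apply: cvgM; first exact: cvg_cst.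
  rewrite -(subrr (q2 theta)); apply: cvgB; first exact: cvg_cst.
  exact: l2_nsq_cvg.
have hd N : (fun k => series (fun n => nsq (z k (theta n))) N) @ \oo --> (0 : R).
  elim: N => [|N IH].
    rewrite (_ : (fun _ => _) = cst 0); first exact: cvg_cst.
    by apply/funext => k; rewrite /series /= big_geq.
  rewrite (_ : (fun _ => _) = (fun k => series (fun n => nsq (z k (theta n))) N +
      nsq (z k (theta N) - 0))).
    by rewrite -[X in _ --> X](addr0 0); apply: cvgD => //; exact: z0.
  by apply/funext => k; rewrite /series /= big_nat_recr //= subr0.
apply: le_null => e e0; have e2 : 0 < e / 2 by rewrite divr_gt0.
have [N /(_ N (leqnn N)) hN] := null_le tl e2.
have [K hK] := null_le (hd N) e2; exists K => k /hK {}hK.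
rewrite ger0_norm ?nphi_ge0 //; apply: (le_trans (htheta _ (Az k))).
apply: (le_trans (tail N k)).
have := ler_norm (c * (q2 theta - series (fun n => nsq (theta n)) N)).
have := ler_norm (series (fun n => nsq (z k (theta n))) N).
lra.
Qed.

(** The vectors zeta turn GNS-Cauchy sequences into Cauchy sequences on the
    commutant span; the common bound extends this to H by density. The limit
    commutes with the commutant of A, hence belongs to A. *)
Lemma nphi_complete (z : nat -> H -> H) c : (forall k, A (z k)) ->
  (forall k, op_bound ip (z k) c) ->
  (forall k l, nphi (z k - z l) <= 2 * (k.+1%:R^-1 + l.+1%:R^-1)) ->
  exists y, [/\ A y, op_bound ip y c & forall v, tends rip (fun k => z k v) (y v)].
Proof.
move=> Az zc zC; have [zeta [hz sep]] := separating_vector.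
have [c0 _] := zc 0%N.
have zl k : complex_linear (z k) by have [] := alg_op (Az k).
pose s (k l : nat) : R := k.+1%:R^-1 + l.+1%:R^-1.
have s0 k l : 0 <= s k l by rewrite addr_ge0 ?invr_ge0.
have span : commutant_span zeta `<=`
    [set u | exists2 C, 0 <= C & forall k l, nsq (z k u - z l u) <= C * s k l].
  apply: commutant_span_sub.
    split=> /=; first by exists 0 => // k l; rewrite (op0 (zl k)) (op0 (zl l)) subrr nsq0 mul0r.
    move=> a u1 u2 [C1 C10 h1] [C2 C20 h2].
    have a0 := sqr_ge0 a.
    exists (2 * (a ^+ 2 * C1 + C2)) => [|k l].
      by rewrite mulr_ge0 // addr_ge0 // mulr_ge0.
    rewrite !zl opprD addrACA -scalerBr.
    apply: (le_trans (nsqD_le _ _ _)); rewrite (form_qZ hH).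
    have hX := h1 k l; have hY := h2 k l.
    have := ler_wpM2l a0 hX; move: hY; clear; set X := nsq _; set Y := nsq _; lra.
  move=> b n bA; have [bl [d [d0 bd]]] := commutant_op bA; have [_ bc] := bA.
  exists (d * 2) => [|k l]; first exact: mulr_ge0.
  have zb k' : z k' (b (zeta n)) = b (z k' (zeta n)).
    exact: (congr1 (fun f => f (zeta n)) (bc _ (Az k'))).
  rewrite !zb -opB //; apply: (le_trans (bd _)); rewrite -mulrA ler_wpM2l //.
  exact: (le_trans (hz _ n (algB (Az k) (Az l)))).
have /choice[y hy] : forall v, exists w, tends rip (fun k => z k v) w.
  move=> v; apply: (form_complete hH) => e e0.
  have [u Lu uv] := commutant_span_dense v sep.
  (* Split v = (v - u_N) + u_N. The first part contributes at most 8 c d and the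
     second 4 C f, with d and f below; the 1 in the denominators covers c = 0
     and C = 0. *)
  have d0 : 0 < e / 16 / (c + 1) by rewrite !divr_gt0 // ltr_pwDr.
  have [N /(_ N (leqnn N)) hN] := null_le uv d0.
  have [C C0 hC] := span _ (Lu N).
  have f0 : 0 < e / 8 / (C + 1) by rewrite !divr_gt0 // ltr_pwDr.
  have [K hK] := null_le (@null_harmonic R) f0; exists K => m n Km Kn.
  have := hN; rewrite ger0_norm ?nsq_ge0 // => {}hN.
  have -> : z m v - z n v = (z m (v - u N) - z n (v - u N))
      + (z m (u N) - z n (u N)).
    rewrite (opB _ _ (zl m)) (opB _ _ (zl n)).
    by rewrite opprB [RHS]addrAC !addrA !subrK.
  apply: (le_trans (nsqD_le _ _ _)).
  have h1 : nsq (z m (v - u N) - z n (v - u N)) <= e / 4.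
    apply: (le_trans (nsqD_le _ _ _)); rewrite (form_opp hH) (form_oppr hH) opprK.
    rewrite (form_qBC hH) in hN.
    have := proj2 (zc m) (v - u N); have := proj2 (zc n) (v - u N).
    have := ler_wpM2l c0 hN.
    set f := e / 16 / (c + 1) in d0 *.
    have : c * f + f = e / 16 by rewrite /f; field; rewrite gt_eqF // ltr_pwDr.
    set X := nsq (z m _); set Y := nsq (z n _); set Z := c * nsq _.
    move: d0; clear; lra.
  have h2 : nsq (z m (u N) - z n (u N)) <= e / 4.
    apply: (le_trans (hC _ _)).
    have := hK m Km; have := hK n Kn; rewrite !ger0_norm ?invr_ge0 //.
    have {f0} f0 := ltW f0; move: f0.
    set f := e / 8 / (C + 1) => f0 hn hm.
    have : C * f + f = e / 8 by rewrite /f; field; rewrite gt_eqF // ltr_pwDr.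
    have hs : s m n <= f + f := lerD hm hn.
    move: (s m n) hs => S hs; have := ler_wpM2l C0 hs.
    rewrite mulrDr; clearbody f; lra.
  lra.
exists y.
have yc : op_bound ip y c.
  split=> // v; have := tends_q hH (hy v) => h.
  by apply: (@cvgr_to_le _ _ _ _ _ _ _ h); apply: nearW => k; have [] := zc k.
have yB u v : y (u - v) = y u - y v.
  apply: (tends_unique hH (hy _)); have := tendsB hH (hy u) (hy v).
  rewrite (_ : (fun k => z k u - z k v) = (fun k => z k (u - v))) //.
  by apply/funext => k; rewrite opB.
have comm b : commutant A b -> forall v, y (b v) = b (y v).
  move=> bA v; have [bl [d [_ bd]]] := commutant_op bA; have [_ bc] := bA.
  apply: (tends_unique hH (hy _)).
  have := tends_map hH (fun s t => opB s t bl) bd (hy v).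
  rewrite (_ : b \o (fun k => z k v) = (fun k => z k (b v))) //.
  by apply/funext => k; apply/esym; exact: (congr1 (fun f => f v) (bc _ (Az k))).
split=> //; apply: bicommutant_alg; split.
  apply/(bounded_opP ip_norm); split; last by exists c.
  by apply: subtractive_linear => // a v; exact: comm (commutant_scalar a) v.
by move=> b bA; apply/funext => v /=; rewrite comm.
Qed.

Lemma nphi_D_le x y : A x -> A y -> nphi (x + y) <= 2 * (nphi x + nphi y).
Proof.
move=> Ax Ay; have := nphi_ge0 (algB Ax Ay); rewrite nphi_B //.
by have := nphi_qD 1 Ax Ay; rewrite rmorph1 scale1r => ->; lra.
Qed.

Lemma expectation_phi N E b x : conditional_expectation ip A phi N E ->
  N `<=` A -> N idfun -> N b -> A x -> phi (b \o E x) = phi (b \o x).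
Proof.
move=> [[EN _ _] _ Ebi Ephi] NA N1 Nb Ax.
have -> : b \o E x = E (b \o x) := esym (Ebi b x idfun Nb Ax N1).
by rewrite Ephi //; apply: algM => //; exact: NA.
Qed.

(** * Actions: fixed points and averages *)

Section Action.
Variables (G : groupType) (rho : G -> (H -> H) -> (H -> H)).
Hypothesis rho_rep : representation ip A phi rho.

Let aut g : automorphism ip A (rho g). Proof. by case: rho_rep. Qed.
Let rho_phi g x : A x -> phi (rho g x) = phi x.
Proof. by case: rho_rep => _ h _; exact: h. Qed.

Lemma rho_alg g x : A x -> A (rho g x).
Proof. exact: automorphism_alg (aut g). Qed.

Lemma rhoM g h x : A x -> rho (g * h)%g x = rho g (rho h x).
Proof. by case: rho_rep => _ _ H0; exact: H0. Qed.

Lemma rho1 x : A x -> rho 1%g x = x.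
Proof.
move=> Ax; have [[_ inj _] _ _ _] := aut 1%g.
apply: inj; rewrite ?inE //; first exact: rho_alg.
by rewrite -rhoM // mul1g.
Qed.

Lemma rho_linear g a x y : A x -> A y ->
  rho g (a *: x + y) = a *: rho g x + rho g y.
Proof. by case: (aut g) => _ h _ _; exact: h. Qed.

Lemma rho_comp g x y : A x -> A y -> rho g (x \o y) = rho g x \o rho g y.
Proof. by case: (aut g) => _ _ h _; exact: h. Qed.

Lemma rho_adjoint g x y : A x -> adjoint x y -> adjoint (rho g x) (rho g y).
Proof. by case: (aut g) => _ _ _ h; exact: h. Qed.

Lemma rhoB g x y : A x -> A y -> rho g (x - y) = rho g x - rho g y.
Proof.
by move=> Ax Ay; have := rho_linear g (-1) Ay Ax; rewrite !scaleN1r addrC => ->; rewrite addrC.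
Qed.

Lemma nphi_rho g x : A x -> nphi (rho g x) = nphi x.
Proof. by move=> Ax; apply: automorphism_nphi => // y; exact: rho_phi. Qed.

Lemma rho_fixV g x : A x -> rho g x = x -> rho g^-1%g x = x.
Proof. by move=> Ax gx; rewrite -{1}gx -rhoM // mulVg rho1. Qed.

Lemma fphi_rho g x y : A x -> A y -> rho g y = y -> fphi (rho g x) y = fphi x y.
Proof.
move=> Ax Ay gy; have [Ays ys] := alg_star Ay.
have gs : rho g (star y) = star y.
  by apply/esym/starP; rewrite -{1}gy; exact: rho_adjoint.
by rewrite /fphi -{1}gs -rho_comp // rho_phi //; exact: algM.
Qed.

Lemma fixed_points_gen (S : set G) x : A x ->
  (forall g, S g -> rho g x = x) -> fixed_points A rho (gen_subgroup S) x.
Proof.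
move=> Ax h; split=> //; apply: gen_subgroup_sub => //; split.
  exact: rho1.
by move=> g k /= gx kx; rewrite rhoM // (rho_fixV Ax kx).
Qed.

(** The image of a fixed point algebra under the action is again one, for the
    conjugate subgroup; this brings the upper left corner of the square under
    the general results on fixed points. *)
Lemma fixed_points_image (K : set G) h :
  rho h @` fixed_points A rho K =
  fixed_points A rho [set g | K (h^-1 * g * h)%g].
Proof.
apply/seteqP; split=> [_ [x [Ax xK] <-]|y [Ay yK]].
  split=> [|g /= Kg]; first exact: rho_alg.
  rewrite -rhoM // -[in RHS](xK _ Kg) -rhoM //.
  by rewrite !mulgA mulgV mul1g.
have Ahy := rho_alg h^-1%g Ay.
exists (rho h^-1%g y); last by rewrite -rhoM // mulgV rho1.
split=> // k Kk; rewrite -[in RHS](yK (h * k * h^-1)%g); last first.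
  by rewrite /= !mulgA mulVg mul1g -mulgA mulVg mulg1.
by rewrite -!rhoM // !mulgA mulVg mul1g.
Qed.

Variable K : set G.
Local Notation B := (fixed_points A rho K).

Lemma fixed_alg x : B x -> A x.
Proof. by case. Qed.

Lemma fixed_star_algebra : star_algebra ip B.
Proof.
split.
- by move=> x [Ax _]; exact: alg_bounded.
- by split=> [|g _]; [exact: alg1|exact: automorphism_id (aut g)].
- move=> a x y [Ax xK] [Ay yK]; split=> [|g Kg]; first exact: alg_lin.
  by rewrite rho_linear // xK // yK.
- move=> x y [Ax xK] [Ay yK]; split=> [|g Kg]; first exact: algM.
  by rewrite rho_comp // xK // yK.
move=> x [Ax xK]; have [Axs xs] := alg_star Ax; exists (star x) => //.
split=> // g Kg; apply/esym/starP; rewrite -{1}(xK g Kg); exact: rho_adjoint.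
Qed.

Let B1 : B idfun. Proof. by case: fixed_star_algebra. Qed.
Let B_lin a x y : B x -> B y -> B (a *: x + y).
Proof. by case: fixed_star_algebra => _ _ h _ _; exact: h. Qed.
Let BM x y : B x -> B y -> B (x \o y).
Proof. by case: fixed_star_algebra => _ _ _ h _; exact: h. Qed.
Let B_star x : B x -> B (star x).
Proof. by case: fixed_star_algebra => _ _ _ _ h /h[y By /starP ->]. Qed.
Let BB x y : B x -> B y -> B (x - y).
Proof. by move=> Bx By; have := B_lin (-1) By Bx; rewrite scaleN1r addrC. Qed.

(** An element of the bicommutant is a GNS limit of fixed points, and the
    automorphisms are isometric for the GNS norm. *)
Lemma fixed_von_neumann : von_neumann_algebra ip B.
Proof.
have [Bb _ _ _ Badj] := fixed_star_algebra; split=> //.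
apply/seteqP; split; last exact: bicommutant_sub.
move=> x xB.
have Ax : A x.
  apply: bicommutant_alg; have [xb xc] := xB; split=> // y [yb yA].
  by apply: xc; split=> // z [Az _]; exact: yA.
split=> // g Kg; apply/eqP; rewrite -subr_eq0; apply/eqP.
have Agx := rho_alg g Ax.
apply: nphi_eq0; first exact: algB.
apply/eqP; rewrite eq_le nphi_ge0 ?andbT; last exact: algB.
apply/ler_addgt0Pr => e e0; rewrite add0r.
have [theta htheta] := nphi_le_vector.
have e4 : 0 < e / 4 by rewrite divr_gt0.
have [m Bm hm] := bicommutant_approx ip_norm theta fixed_star_algebra xB e4.
have [Am mK] := Bm; have Axm := algB Ax Am.
have xm : nphi (x - m) <= e / 4.
  apply: le_trans (htheta _ Axm) _; apply: le_trans hm.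
  have [_ [c xc]] := alg_op Ax; have [_ [d md]] := alg_op Am.
  have := amplify_lin (-1) theta md xc; rewrite !scaleN1r addrC => ->.
  by rewrite addrC.
rewrite (_ : rho g x - x = rho g (x - m) + (m - x)); last first.
  by rewrite rhoB // (mK g Kg) addrA subrK.
have Amx := algB Am Ax.
apply: (le_trans (nphi_D_le (rho_alg g Axm) Amx)).
rewrite nphi_rho // (_ : nphi (m - x) = nphi (x - m)); first lra.
by rewrite !nphi_B // (fphi_sym Ax Am); ring.
Qed.

(** Apply the hypothesis to b = (x - y)*. *)
Lemma fixed_unique x y : B x -> B y ->
  (forall b, B b -> Re (phi (b \o x)) = Re (phi (b \o y))) -> x = y.
Proof.
move=> Bx By h; apply/eqP; rewrite -subr_eq0; apply/eqP.
have Bd := BB Bx By; have [[Ax _] [Ay _] [Ad _]] := And3 Bx By Bd.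
have [As _] := B_star Bd; have [sl _] := alg_op As.
apply: nphi_eq0 => //; rewrite /nphi /fphi.
rewrite (_ : star (x - y) \o (x - y) =
    (star (x - y) \o x) - (star (x - y) \o y)).
  rewrite phiB; try exact: algM.
  by rewrite ReD ReN h ?subrr //; exact: B_star.
by apply/funext => v; rewrite /= opB.
Qed.

(** Midpoints replace convex combinations: the minimization only uses them. *)
Definition midpoint_closed (C : set (H -> H)) : Prop :=
  forall x y, C x -> C y -> C ((2^-1)%:C *: x + (2^-1)%:C *: y).

Definition orbit_hull x : set (H -> H) :=
  smallest midpoint_closed [set y | exists2 g, K g & y = rho g x].

Lemma orbit_hull_sub x (C : set (H -> H)) : midpoint_closed C ->
  (forall g, K g -> C (rho g x)) -> orbit_hull x `<=` C.
Proof. by move=> Cm h; apply: smallest_sub => // _ [g Kg ->]; exact: h. Qed.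

Lemma orbit_hull_midpoint x : midpoint_closed (orbit_hull x).
Proof. by move=> y z hy hz C hC; apply: (proj1 hC); [exact: hy|exact: hz]. Qed.

Lemma orbit_hull_gen x g : K g -> orbit_hull x (rho g x).
Proof. by move=> Kg C [_ h]; apply: h; exists g. Qed.

Lemma orbit_hull_alg x : A x -> orbit_hull x `<=` A.
Proof.
move=> Ax; apply: orbit_hull_sub => [y z Ay Az|g _]; last exact: rho_alg.
by apply: alg_lin => //; exact: algZ.
Qed.

Lemma midpoint_bound y z c : op_bound ip y c -> op_bound ip z c ->
  op_bound ip ((2^-1)%:C *: y + (2^-1)%:C *: z) c.
Proof.
move=> [c0 yc] [_ zc]; split=> // v.
rewrite -[(_ + _) v]/((2^-1)%:C *: y v + (2^-1)%:C *: z v).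
apply: (le_trans (nsqD_le _ _ _)); rewrite !(form_qZ hH).
by have := yc v; have := zc v; lra.
Qed.

Lemma orbit_hull_bound x c : A x -> op_bound ip x c ->
  orbit_hull x `<=` [set y | op_bound ip y c].
Proof.
move=> Ax xc; apply: orbit_hull_sub => [y z|g _]; first exact: midpoint_bound.
by apply: automorphism_bound => // y; exact: rho_phi.
Qed.

Hypothesis K_subgroup : subgroup K.

Lemma orbit_hull_rho x h : A x -> K h ->
  orbit_hull x `<=` [set y | A y /\ orbit_hull x (rho h y)].
Proof.
move=> Ax Kh; apply: orbit_hull_sub => [y z [Ay hy] [Az hz]|g Kg].
  split; first by apply: alg_lin => //; exact: algZ.
  rewrite rho_linear //; last exact: algZ.
  have -> : rho h ((2^-1)%:C *: z) = (2^-1)%:C *: rho h z.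
    have := rho_linear h ((2^-1)%:C) Az alg0; rewrite addr0 => ->.
    have -> : rho h 0 = 0.
      have := rho_linear h (-1) alg1 alg1; rewrite scaleN1r addNr => ->.
      by rewrite scaleN1r addNr.
    by rewrite addr0.
  exact: orbit_hull_midpoint.
split; first exact: rho_alg.
by rewrite -rhoM //; apply: orbit_hull_gen; exact: (subgroupM K_subgroup).
Qed.

(** Bounded pointwise convergence is recorded, rather than GNS convergence,
    because it survives multiplication by operators on the right. *)
Definition average x y : Prop :=
  B y /\ exists z c, [/\ forall k : nat, orbit_hull x (z k),
    forall k, op_bound ip (z k) c & forall v, tends rip (fun k => z k v) (y v)].

Lemma bounded_limit_nphi (z : nat -> H -> H) y c : (forall k, A (z k)) -> A y ->
  (forall k, op_bound ip (z k) c) ->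
  (forall v, tends rip (fun k => z k v) (y v)) ->
  (fun k => nphi (z k - y)) @ \oo --> (0 : R).
Proof.
move=> Az Ay zc zy; have [_ [d yd]] := alg_op Ay.
apply: (pointwise_null_nphi (c := 2 * (Re (`|-1 : R[i]| ^+ 2) * d + c))).
- by move=> k; exact: algB.
- by move=> k; have := op_bound_lin (-1) yd (zc k); rewrite scaleN1r addrC.
move=> v; have := tendsB hH (zy v) (tends_cst hH (y v)).
by rewrite subrr.
Qed.

(** Minimize the GNS norm on the hull of the orbit. As g preserves the hull and
    the norm, it maps a minimizing sequence z to another one, and the midpoints
    of the two show that g z_k - z_k tends to 0: the limit is fixed. *)
Lemma average_exists x : A x -> exists y, average x y.
Proof.
move=> Ax; have [_ [c xc]] := alg_op Ax.
have hA := orbit_hull_alg Ax.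
have par y z : A y -> A z ->
    nphi ((2^-1)%:C *: y + (2^-1)%:C *: z) = (nphi y + nphi z) / 2 - nphi (y - z) / 4.
  move=> Ay Az; rewrite nphi_qD //; last exact: algZ.
  have := nphi_qD (2^-1) Az alg0; rewrite !addr0 => ->.
  have z0 : fphi z 0 = 0.
    rewrite (fphi_sym Az alg0); have := fphi_lin 1 alg0 alg0 Az.
    by rewrite scaler0 addr0; lra.
  have n0 : nphi 0 = 0.
    have := fphi_lin 1 alg0 alg0 alg0; rewrite scaler0 addr0.
    by rewrite /nphi; lra.
  have := fphi_lin (2^-1) Az alg0 Ay; rewrite addr0 (fphi_sym alg0 Ay).
  have y0 : fphi y 0 = 0.
    rewrite (fphi_sym Ay alg0); have := fphi_lin 1 alg0 alg0 Ay.
    by rewrite scaler0 addr0; lra.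
  rewrite y0 z0 n0 (fphi_sym Ay (algZ _ Az)) nphi_B // => ->.
  by rewrite (fphi_sym Az Ay); lra.
have K1 : K 1%g by case: K_subgroup.
have ne : orbit_hull x !=set0 by exists (rho 1%g x); exact: orbit_hull_gen.
have [|y z hy hz|z [hz zQ zJ]] := @minimizing_sequence R (H -> H) (orbit_hull x)
    nphi (fun y z => nphi (y - z)) 0 ne.
- by move=> y /hA; exact: nphi_ge0.
- by eexists; [exact: orbit_hull_midpoint hy hz|rewrite par //; exact: hA].
have Az k : A (z k) by exact: hA.
have zc k : op_bound ip (z k) c by exact: orbit_hull_bound xc _ (hz k).
have [y [Ay yc zy]] := nphi_complete Az zc zQ.
exists y; split; last by exists z, c.
split=> // g Kg; apply/eqP; rewrite -subr_eq0; apply/eqP.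
have Agy := rho_alg g Ay.
apply: nphi_eq0; first exact: algB.
have zy0 := bounded_limit_nphi Az Ay zc zy.
have gz k : nphi (rho g (z k) - z k) <= 4 * k.+1%:R^-1.
  have [_ hg] := orbit_hull_rho Ax Kg (hz k).
  have := zJ _ k (orbit_hull_midpoint hg (hz k)).
  rewrite par ?nphi_rho //; last exact: rho_alg.
  by set a := k.+1%:R^-1; clearbody a; lra.
have bnd k : 0 <= nphi (rho g y - y) <=
    6 * nphi (z k - y) + 16 * k.+1%:R^-1.
  rewrite nphi_ge0 /=; last exact: algB.
  have Azy := algB (Az k) Ay; have Ayz := algB Ay (Az k).
  have Agz := rho_alg g (Az k); have Agzz := algB Agz (Az k).
  rewrite (_ : rho g y - y = rho g (y - z k) + ((rho g (z k) - z k) + (z k - y))).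
    have h1 := nphi_D_le (rho_alg g Ayz) (algD Agzz Azy).
    have h2 := nphi_D_le Agzz Azy.
    rewrite nphi_rho // in h1.
    have e1 : nphi (y - z k) = nphi (z k - y).
      by rewrite !nphi_B // (fphi_sym Ay (Az k)); ring.
    have := gz k; move: h1 h2; rewrite e1.
    by set a := k.+1%:R^-1; clearbody a; lra.
  by rewrite rhoB // !addrA !subrK.
apply: (cvg_const_eq (a := fun=> nphi (rho g y - y))) => //.
apply: null_squeeze bnd _.
rewrite -[X in _ --> X](addr0 0); apply: cvgD.
  by rewrite -(mulr0 6); apply: cvgM => //; exact: cvg_cst.
by rewrite -(mulr0 16); apply: cvgM; [exact: cvg_cst|exact: null_harmonic].
Qed.

(** The map phi (b _ d) is constant on the orbit, hence on its hull, and it is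
    continuous along bounded pointwise limits. For the imaginary part, replace b
    by i b. *)
Lemma average_phi x y b d : A x -> average x y -> B b -> B d ->
  phi (b \o y \o d) = phi (b \o x \o d).
Proof.
move=> Ax [By [z [c [hz zc zy]]]].
have re b' d' : B b' -> B d' -> Re (phi (b' \o y \o d')) = Re (phi (b' \o x \o d')).
  move=> Bb Bd; have [[Ab bK] [Ad dK]] := conj Bb Bd; have [Ay _] := By.
  have hull : orbit_hull x `<=`
      [set w | A w /\ phi (b' \o w \o d') = phi (b' \o x \o d')].
    apply: orbit_hull_sub => [u w [Au hu] [Aw hw]|g Kg].
      split; first by apply: alg_lin => //; exact: algZ.
      have [bl _] := alg_op Ab.
      have -> : b' \o ((2^-1)%:C *: u + (2^-1)%:C *: w) \o d' =
          (2^-1)%:C *: (b' \o u \o d') + (2^-1)%:C *: (b' \o w \o d').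
        apply/funext => v.
        rewrite -[LHS]/(b' ((2^-1)%:C *: u (d' v) + (2^-1)%:C *: w (d' v))).
        by rewrite bl opZ.
      have Au' := algM (algM Ab Au) Ad; have Aw' := algM (algM Ab Aw) Ad.
      rewrite phi_lin //; last exact: algZ.
      rewrite phiZ // hu hw -mulrDl -rmorphD /=.
      have -> : 2^-1 + 2^-1 = 1 :> R by lra.
      by rewrite rmorph1 mul1r.
    split; first exact: rho_alg.
    rewrite -{1}(bK g Kg) -{1}(dK g Kg) -!rho_comp //; try exact: algM.
    by rewrite rho_phi //; exact: algM (algM Ab Ax) Ad.
  have Az k : A (z k) by have [] := hull _ (hz k).
  have [bl [cb bcb]] := alg_op Ab; have [dl [cd dcd]] := alg_op Ad.
  pose w k := b' \o z k \o d'.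
  have Aw k : A (w k) by exact: algM (algM Ab (Az k)) Ad.
  have Ay' : A (b' \o y \o d') by exact: algM (algM Ab Ay) Ad.
  have w0 : (fun k => nphi (w k - (b' \o y \o d'))) @ \oo --> (0 : R).
    apply: (@bounded_limit_nphi _ _ (cb * c * cd)) => // [k|v].
      by do 2![apply: op_bound_comp => //].
    exact: tends_map hH (fun s t => opB s t bl) (proj2 bcb) (zy (d' v)).
  apply/esym/eqP; rewrite -subr_eq0 -sqrf_eq0; apply/eqP.
  apply: (@cvg_const_eq _ _ 0 (fun=> (Re _ - Re _) ^+ 2)) => //.
  apply: null_squeeze w0 => k; rewrite sqr_ge0 /=.
  have := fphi_CS (algB (Aw k) Ay') alg1.
  rewrite nphi1 mulr1 fphi1 phiB // ReD ReN.
  by have [_ ->] := hull _ (hz k).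
move=> Bb Bd; apply: complex_eq; first exact: re.
have Bib : B ('i%C *: b).
  have := B_lin ('i%C - 1) Bb Bb.
  by rewrite -{2}[b]scale1r -scalerDl subrK.
have [[Ab _] [Ad _] [Ay _]] := And3 Bb Bd By.
have := re _ _ Bib Bd.
have E w : A w -> phi (('i%C *: b) \o w \o d) = 'i%C * phi (b \o w \o d).
  by move=> Aw; rewrite -phiZ //; exact: algM (algM Ab Aw) Ad.
by rewrite !E.
Qed.

Lemma average_unique x y E : A x -> conditional_expectation ip A phi B E ->
  average x y -> E x = y.
Proof.
move=> Ax hE av; have [[EB _ _] _ _ _] := hE; have [By _] := av.
apply: fixed_unique => //; first exact: EB.
move=> b Bb; rewrite (expectation_phi hE) //; last exact: fixed_alg.
by have -> : phi (b \o y) = phi (b \o x) := average_phi Ax av Bb B1.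
Qed.

Lemma average_positive x x' y v : A x -> adjoint x x' -> average (x' \o x) y ->
  0 <= ip (y v) v.
Proof.
move=> Ax xx' [_ [z [c [hz _ zy]]]].
have [Ax' _] := alg_star Ax; rewrite (starP xx') in Ax'.
have hull : orbit_hull (x' \o x) `<=` [set w | 0 <= ip (w v) v].
  apply: orbit_hull_sub => [u w hu hw|g _] /=.
    rewrite -[(_ + _) v]/((2^-1)%:C *: u v + (2^-1)%:C *: w v) ipDl !ipZl.
    by rewrite addr_ge0 // mulr_ge0 // lecR invr_ge0.
  have gx := rho_adjoint g Ax xx'.
  by rewrite rho_comp //= (adjointC gx); exact: dnorm_ge0.
have ImE w : complex.Im (ip w v) = rip w ('i%C *: v).
  by rewrite /real_ip ipZr conj_i mulNr ReN Re_iM opprK.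
rewrite lecE /= ImE; apply/andP; split.
  apply/eqP/esym; apply: (cvg_const_eq _ (tends_form hH (zy v))) => k.
  by rewrite -ImE; have [-> _] := Re_ge0 (hull _ (hz k)).
apply: (@cvgr_to_ge _ _ _ _ _ _ _ (tends_form hH (zy v))); apply: nearW => k.
by have [] := Re_ge0 (hull _ (hz k)).
Qed.

Lemma fixed_conditioned : conditioned ip A phi B.
Proof.
split; [exact: fixed_von_neumann|exact: fixed_alg|].
have /choice[E hE] : forall x, exists y, A x -> average x y.
  move=> x; have [Ax|nAx] := pselect (A x); last by exists x.
  by have [y hy] := average_exists Ax; exists y.
have EB x : A x -> B (E x) by move=> /hE[].
have Ebi b x d : B b -> A x -> B d -> phi (b \o E x \o d) = phi (b \o x \o d).
  by move=> Bb Ax Bd; exact: average_phi (hE x Ax) Bb Bd.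
have El b x : B b -> A x -> phi (b \o E x) = phi (b \o x).
  by move=> Bb Ax; exact: Ebi Bb Ax B1.
have bilin b a x y : A b -> A x -> A y ->
    phi (b \o (a *: x + y)) = a * phi (b \o x) + phi (b \o y).
  move=> Ab Ax Ay; have [bl _] := alg_op Ab.
  rewrite -phi_lin; try exact: algM.
  by congr phi; apply/funext => v; rewrite -[LHS]/(b (a *: x v + y v)) bl.
exists E; split.
- split=> // [b Bb|a x y Ax Ay].
    have [Ab _] := Bb; apply: fixed_unique => // [|b' Bb']; first exact: EB.
    by rewrite El.
  have Axy := alg_lin a Ax Ay.
  apply: fixed_unique => [||b Bb]; first exact: EB.
    by apply: B_lin; exact: EB.
  have [Ab _] := Bb.
  by rewrite El // !bilin ?El //; apply: fixed_alg; exact: EB.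
- move=> x y v Ax xy; apply: (average_positive v Ax xy); apply: hE.
  by have [Ay _] := alg_star Ax; rewrite (starP xy) in Ay; exact: algM.
- move=> b x d Bb Ax Bd; have [[Ab _] [Ad _]] := conj Bb Bd.
  have Abxd : A (b \o x \o d) := algM (algM Ab Ax) Ad.
  apply: fixed_unique => [||b' Bb']; first exact: EB.
    by apply: BM => //; apply: BM => //; exact: EB.
  rewrite El //; congr Re.
  exact: esym (Ebi (b' \o b) x d (BM Bb' Bb) Ax Bd).
- by move=> x Ax; have := El _ _ B1 Ax.
Qed.

End Action.

(** * The tower of fixed point algebras *)

Section Tower.
Variable rho : braid -> (H -> H) -> (H -> H).
Hypothesis rho_rep : representation ip A phi rho.
Local Notation tower := (braid_tower A rho).

Lemma towerP n x : tower n x <->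
  A x /\ forall k, (n < k)%N -> rho (sigma k) x = x.
Proof.
split=> [[Ax h]|[Ax h]].
  by split=> // k nk; apply: h; exact: sigma_from.
by apply: (fixed_points_gen rho_rep) => // _ [k [_ nk] <-]; exact: h.
Qed.

Lemma tower_subset n : tower n `<=` tower n.+1.
Proof. by move=> x /towerP[Ax h]; apply/towerP; split=> // k /ltnW; exact: h. Qed.

Lemma sigma_tower n : {homo rho (sigma n.+1) : x / tower n.+2 x}.
Proof.
move=> x /towerP[Ax h]; apply/towerP; split=> [|k nk]; first exact: (rho_alg rho_rep).
rewrite -(rhoM rho_rep) // -sigma_far //.
by rewrite (rhoM rho_rep) // h.
Qed.

(** A braid involves finitely many generators. This is expressed through the
    elements that they fix, so that it passes to products and inverses. *)
Lemma braid_from_finite n g : braid_from n.+1 g -> exists m, forall w, A w ->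
  (forall j, (n < j)%N -> (j < m)%N -> rho (sigma j) w = w) -> rho g w = w.
Proof.
move: g; apply: gen_subgroup_sub.
  split=> [|g k [m1 h1] [m2 h2]].
    by exists 0%N => w Aw _; exact: (rho1 rho_rep).
  exists (maxn m1 m2) => w Aw hw.
  have gw : rho g w = w by apply: h1 => // j nj jm; apply: hw => //; rewrite leq_max jm.
  have kw : rho k w = w by apply: h2 => // j nj jm; apply: hw => //; rewrite leq_max jm orbT.
  by rewrite (rhoM rho_rep) // (rho_fixV rho_rep Aw kw).
by move=> _ [k [_ nk] <-]; exists k.+1 => w _; exact.
Qed.

(** The heart of the matter. Let y' be the average of y over the larger group
    and w_k the shifted copies of x. Each element u of the hull of y for the
    larger group involves finitely many generators, which fix w_k for large k,
    so that <u, w_k> = <y, w_k>. Moreover <b, w_k> = <b, y> for all k when b is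
    fixed by the smaller group. Hence <y - y', y> is the limit of the numbers
    <u - y', w_k> as u tends to y', namely 0; and <y - y', y'> = 0 because y' is
    the average of y. *)
Lemma shifted_average_fixed n x y : tower n.+1 x ->
  average rho (braid_from n.+2) (rho (sigma n.+1) x) y -> tower n y.
Proof.
move=> /towerP[Ax xfix] av; have By := proj1 av.
have sub1 : subgroup (braid_from n.+1) by exact: gen_subgroupP.
have sub2 : subgroup (braid_from n.+2) by exact: gen_subgroupP.
have Ay := proj1 By.
have [y' av'] := average_exists rho_rep sub1 Ay.
have [By' [z [c [hz zc zy]]]] := av'.
have By'2 : tower n.+1 y' by exact: tower_subset.
have Ay' := proj1 By'.
have Ad := algB Ay Ay'.
have Asx := rho_alg rho_rep (sigma n.+1) Ax.
pose w k := rho (shift_word n k.+1) x.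
have Aw k : A (w k) by exact: (rho_alg rho_rep).
have wfix k j : (n < j)%N -> (j < n + k.+1)%N -> rho (sigma j) (w k) = w k.
  move=> nj jk; rewrite -(rhoM rho_rep) // shift_word_sigma // (rhoM rho_rep) //.
  by rewrite xfix.
have star_alg := fixed_star_algebra rho_rep.
have starB m b : tower m b -> tower m (star b).
  by move=> Bb; case: (star_alg (braid_from m.+1)) => _ _ _ _ /(_ b Bb)[b' Bb' /starP ->].
have oneB m : tower m idfun by case: (star_alg (braid_from m.+1)).
have pair k b : tower n.+1 b -> fphi (w k) b = fphi y b.
  move=> Bb; have [Ab bfix] := Bb; have [Abs bs] := alg_star Ab.
  have [g Kg gE] := shift_word_factor n k.
  rewrite /w gE (rhoM rho_rep) // (fphi_rho rho_rep Asx Ab (bfix g Kg)).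
  have := average_phi rho_rep Asx av (starB _ _ Bb) (oneB _).
  by move=> /(congr1 (@complex.Re R)) h; exact: esym h.
have pair' b : tower n b -> fphi y' b = fphi y b.
  move=> Bb; have := average_phi rho_rep Ay av' (starB _ _ Bb) (oneB _).
  by move=> /(congr1 (@complex.Re R)) h; exact: h.
have hull : orbit_hull rho (braid_from n.+1) y `<=` [set u | A u /\ exists m,
    forall v, A v -> (forall j, (n < j)%N -> (j < m)%N -> rho (sigma j) v = v) ->
    fphi u v = fphi y v].
  apply: orbit_hull_sub => [u1 u2 [Au1 [m1 h1]] [Au2 [m2 h2]]|g Kg].
    split; first by apply: alg_lin => //; exact: algZ.
    exists (maxn m1 m2) => v Av hv.
    have e1 : fphi u1 v = fphi y v.
      by apply: h1 => // j nj jm; apply: hv => //; rewrite leq_max jm.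
    have e2 : fphi u2 v = fphi y v.
      by apply: h2 => // j nj jm; apply: hv => //; rewrite leq_max jm orbT.
    rewrite fphi_lin // ?e1; last exact: algZ.
    have := fphi_lin (2^-1) Au2 alg0 Av; have := fphi_lin 1 alg0 alg0 Av.
    rewrite scaler0 !addr0 e2 => h0 ->; lra.
  split; first exact: (rho_alg rho_rep).
  have [m hm] := braid_from_finite Kg; exists m => v Av hv.
  by apply: (fphi_rho rho_rep Ay Av); exact: hm.
(* w m is used with the index m itself: the generators that are involved have
   an index below m, and w m is fixed by those of index at most n + m. *)
have key : fphi y (y - y') = 0.
  apply/eqP; rewrite -sqrf_eq0; apply/eqP.
  have Az k : A (z k) by exact: (proj1 (hull _ (hz k))).
  have z0 := bounded_limit_nphi Az Ay' zc zy.
  apply: (@cvg_const_eq _ _ 0 (fun=> fphi y (y - y') ^+ 2)) => //.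
  apply: (@null_squeeze _ _ (fun k => nphi (z k - y') * nphi x)).
    move=> l; rewrite sqr_ge0 /=; have [Azl [m hm]] := hull _ (hz l).
    have Ed : fphi (z l - y') (w m) = fphi y (y - y').
      have hw : fphi (z l) (w m) = fphi y (w m).
        apply: hm => // j nj jm; apply: wfix => //.
        by apply: leq_trans jm _; rewrite addnS ltnW // ltnS leq_addl.
      have Bd : tower n.+1 (y - y').
        case: (star_alg (braid_from n.+2)) => _ _ h _ _.
        by have := h (-1) _ _ By'2 By; rewrite scaleN1r addrC.
      rewrite -(pair m) // (fphi_sym (Aw m) Ad).
      have fB u : A u -> fphi (u - y') (w m) = fphi u (w m) - fphi y' (w m).
        move=> Au; have := fphi_lin (-1) Ay' Au (Aw m).
        by rewrite rmorphN rmorph1 scaleN1r mulN1r addrC => ->; rewrite addrC.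
      by rewrite !fB // hw.
    rewrite -Ed -(nphi_rho rho_rep (shift_word n m.+1) Ax).
    exact: fphi_CS (algB Azl Ay') (Aw m).
  by rewrite -(mul0r (nphi x)); apply: cvgM => //; exact: cvg_cst.
suff -> : y = y' by [].
apply/eqP; rewrite -subr_eq0; apply/eqP; apply: nphi_eq0 => //.
rewrite nphi_B //; have := pair' _ By'.
have := fphi_lin (-1) Ay' Ay Ay; rewrite rmorphN rmorph1 scaleN1r mulN1r [_ + y]addrC.
rewrite (fphi_sym Ad Ay) key (fphi_sym Ay' Ay) /nphi; lra.
Qed.

Lemma tower_von_neumann n : von_neumann_algebra ip (tower n).
Proof. exact: (fixed_von_neumann rho_rep). Qed.

Lemma tower_automorphism n :
  automorphism ip (tower n.+2) (rho (sigma n.+1)).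
Proof.
have sub : tower n.+2 `<=` A by move=> x [].
have [aut _ _] := rho_rep; have [[_ inj _] lin mul adj] := aut (sigma n.+1).
split=> [|a x y Tx Ty|x y Tx Ty|x y Tx]; last first.
- by apply: adj; exact: sub.
- by apply: mul; exact: sub.
- by apply: lin; exact: sub.
split; first exact: sigma_tower.
  by move=> x y; rewrite !inE => Tx Ty; apply: inj; rewrite inE; exact: sub.
move=> y /towerP[Ay h].
have Aiy := rho_alg rho_rep (sigma n.+1)^-1%g Ay.
exists (rho (sigma n.+1)^-1%g y); last first.
  by rewrite -(rhoM rho_rep) // mulgV (rho1 rho_rep).
apply/towerP; split=> // k nk; rewrite -(rhoM rho_rep) //.
have -> : (sigma k * (sigma n.+1)^-1 = (sigma n.+1)^-1 * sigma k)%g.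
  by apply: (mulgI (sigma n.+1)); rewrite !mulgA sigma_far // mulgK mulgV mul1g.
by rewrite (rhoM rho_rep) // h.
Qed.

Lemma tower_commuting_square n : commuting_square ip A phi (tower n)
  (tower n.+1) (rho (sigma n.+1) @` tower n.+1) (tower n.+2).
Proof.
have cond m : conditioned ip A phi (tower m).
  by apply: (fixed_conditioned rho_rep); exact: gen_subgroupP.
have N2 : tower n `<=` rho (sigma n.+1) @` tower n.+1.
  by move=> x /[dup] /tower_subset Tx /towerP[_ h]; exists x => //; exact: h.
have oneB m : tower m idfun.
  by case: (fixed_star_algebra rho_rep (braid_from m.+1)).
split; first split=> //; try exact: tower_subset.
- by move=> _ [x /tower_subset Tx <-]; exact: sigma_tower.
- split=> //; rewrite (fixed_points_image rho_rep).
  apply: (fixed_conditioned rho_rep).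
  by apply: conjugate_subgroup; exact: gen_subgroupP.
move=> E E1 E2 hE hE1 hE2 x Ax.
have [[EN _ _] _ _ _] := hE; have [[E2N _ _] _ _ _] := hE2.
have sub2 : subgroup (braid_from n.+2) by exact: gen_subgroupP.
have T2A : rho (sigma n.+1) @` tower n.+1 `<=` A.
  by move=> _ [w [Aw _] <-]; exact: (rho_alg rho_rep).
have AE2 := T2A _ (E2N x Ax).
have fixE : tower n (E1 (E2 x)).
  have [w Tw wE] := E2N x Ax.
  have [a av] := average_exists rho_rep sub2 AE2.
  rewrite (average_unique rho_rep AE2 hE1 av).
  by apply: shifted_average_fixed Tw _; rewrite wE.
apply: (fixed_unique rho_rep fixE (EN x Ax)) => b Tb.
rewrite (expectation_phi hE) //; last by move=> y [].
rewrite (expectation_phi hE1) //; [|by move=> y []|exact: tower_subset].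
by rewrite (expectation_phi hE2) //; exact: N2.
Qed.

End Tower.

End State.

Theorem theorem2p7 (R : realType) (H : completeNormedModType R[i])
    (ip : {dot H for @Num.conj R[i]}) (ip_norm : induces_norm ip)
    (A : set (H -> H)) (phi : (H -> H) -> R[i])
    (A_phi : probability_space ip A phi)
    (rho : braid -> (H -> H) -> (H -> H))
    (rho_rep : representation ip A phi rho) :
  (forall n : nat,
      [/\ von_neumann_algebra ip (braid_tower A rho n),
          braid_tower A rho n `<=` braid_tower A rho n.+1
        & braid_tower A rho n `<=` A]) /\
  (forall n : nat,
      automorphism ip (braid_tower A rho n.+2) (rho (sigma n.+1)) /\
      commuting_square ip A phi
        (braid_tower A rho n)
        (braid_tower A rho n.+1)
        (rho (sigma n.+1) @` braid_tower A rho n.+1)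
        (braid_tower A rho n.+2)).
Proof.
split=> n.
  split; first exact: (tower_von_neumann ip_norm A_phi rho_rep).
    exact: (tower_subset rho_rep).
  by move=> x [].
split; first exact: (tower_automorphism rho_rep).
exact: (tower_commuting_square ip_norm A_phi rho_rep).
Qed.
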